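(* Let $\alpha_1,\alpha_2>0$ satisfy $\alpha_1+2\alpha_2=1$, and let $\sigma_{\alpha_1,\alpha_2}$ be the probability measure $$\sigma_{\alpha_1,\alpha_2}(dx)=\frac{\sqrt{\left(x-\frac{1}{(\sqrt{2}+1)^2}\right)\left(\frac{1}{(\sqrt{2}-1)^2}-x\right)}}{2\pi x}\left(\frac{\alpha_1}{x}+\frac{\alpha_2}{x^2}\right)1_{\left(1/(\sqrt{2}+1)^2,\,1/(\sqrt{2}-1)^2\right)}(x)\,dx .$$ If a (noncommutative) random variable $X$ has distribution $\sigma_{\alpha_1,\alpha_2}$, then the distribution of $X^{-1}$ is not freely infinitely divisible.
   Context: The distribution of $X^{-1}$ is the push-forward of the distribution of $X$ under $x\mapsto x^{-1}$. Free infinite divisibility: for a probability measure $\mu$ on $\mathbb{R}$ let $G_\mu(z)=\int_{\mathbb{R}}\frac{1}{z-x}\,d\mu(x)$ be its Cauchy transform on the upper half-plane. It has a right inverse $G_\mu^{-1}$ on a domain $\Lambda_{\gamma,\delta}=\{z:\ \gamma|\mathrm{Re}(z)|<-\mathrm{Im}(z),\ -\delta<\mathrm{Im}(z)<0\}$ (for any $\gamma>0$ and suitable $\delta>0$), and the Voiculescu transform is $\phi_\mu(z)=G_\mu^{-1}(1/z)-z$ for $1/z\in\Lambda_{\gamma,\delta}$. The free convolution $\mu\boxplus\nu$ is the unique probability measure with $\phi_{\mu\boxplus\nu}=\phi_\mu+\phi_\nu$ on the common domain. $\mu$ is freely infinitely divisible if for each $n\in\mathbb{N}$ there is a probability measure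 $\rho_n$ on $\mathbb{R}$ with $\mu=\rho_n^{\boxplus n}$. *)

(* Defs.v *)
From HB Require Import structures.
From mathcomp Require Import all_boot all_order all_algebra complex.
From mathcomp Require Import all_classical all_reals all_analysis.
From mathcomp Require Import measurable_realfun.

Set Implicit Arguments.
Unset Strict Implicit.
Unset Printing Implicit Defensive.

Import Order.TTheory GRing.Theory Num.Theory.
Import numFieldNormedType.Exports.

Local Open Scope classical_set_scope.
Local Open Scope ring_scope.
Local Open Scope complex_scope.

(** The library has no Bochner integral, hence no integral of a complex-valued
    function: the Cauchy transform is integrated componentwise. *)
Definition cauchy_transform (R : realType) (mu : probability (measurableTypeR R) R)
    (z : R[i]) : R[i] :=
  (\int[mu]_x complex.Re ((z - x%:C)^-1)) +i*
  (\int[mu]_x complex.Im ((z - x%:C)^-1)).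

(** The truncated cone Lambda_{g,d}, in the lower half-plane with apex 0. *)
Definition Lambda (R : realType) (g d : R) : set R[i] :=
  [set w | g * `|complex.Re w| < - complex.Im w /\
           - d < complex.Im w /\ complex.Im w < 0].

(** A right inverse of the Cauchy transform on [Lambda g d], with values in the
    upper half-plane where the Cauchy transform is considered.  Being a right
    inverse does not determine the function: for
    mu = (delta_{-1} + delta_1) / 2, the equation G_mu(z) = w has two solutions
    in the upper half-plane for w near 0 in [Lambda g d], one equivalent to
    1/w and one to -w.  As usual, G_mu^{-1} is the holomorphic branch that is
    equivalent to 1/w at the apex.  In [derivable H w 1] the scalars are
    complex, so that it means complex differentiability at w. *)
Definition is_cauchy_right_inverse (R : realType)
    (mu : probability (measurableTypeR R) R) (g d : R) (H : R[i] -> R[i]) : Prop :=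
  [/\ forall w, Lambda g d w ->
        0 < complex.Im (H w) /\ cauchy_transform mu (H w) = w,
      forall w, Lambda g d w -> derivable (H : R[i]^o -> R[i]^o) w 1 &
      w * H w @[w --> within (Lambda g d) (nbhs (0 : R[i]^o))] --> (1 : R[i]^o)].

(** [phi] is the Voiculescu transform of [mu] at the points z such that 1/z
    lies in [Lambda g d]; its values elsewhere are irrelevant. *)
Definition is_voiculescu_transform (R : realType)
    (mu : probability (measurableTypeR R) R) (g d : R) (phi : R[i] -> R[i]) : Prop :=
  exists2 H, is_cauchy_right_inverse mu g d H &
    forall z, Lambda g d z^-1 -> phi z = H z^-1 - z.

(** [is_free_convolution mu nu rho]: rho is the free convolution of mu and nu.
    The free convolution is given by its graph, since its totality is a theorem.
    The three transforms may be taken on the same truncated cone because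
    [Lambda g d] decreases when d does. *)
Definition is_free_convolution (R : realType)
    (mu nu rho : probability (measurableTypeR R) R) : Prop :=
  forall g : R, 0 < g -> exists2 d : R, 0 < d &
    exists phi_mu phi_nu phi_rho : R[i] -> R[i],
      [/\ is_voiculescu_transform mu g d phi_mu,
          is_voiculescu_transform nu g d phi_nu,
          is_voiculescu_transform rho g d phi_rho &
          forall z, Lambda g d z^-1 -> phi_rho z = phi_mu z + phi_nu z].

(** [is_free_power rho n mu]: mu is the n-fold free convolution of rho, n >= 1.
    Measures are functions on all sets, so they are compared on measurable
    sets only. *)
Inductive is_free_power (R : realType) (rho : probability (measurableTypeR R) R) :
    nat -> probability (measurableTypeR R) R -> Prop :=
| free_power1 (mu : probability (measurableTypeR R) R) :
    (forall A : set (measurableTypeR R), measurable A -> mu A = rho A) ->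
    is_free_power rho 1 mu
| free_powerS (n : nat) (nu mu : probability (measurableTypeR R) R) :
    is_free_power rho n nu -> is_free_convolution nu rho mu ->
    is_free_power rho n.+1 mu.

Definition freely_infinitely_divisible (R : realType)
    (mu : probability (measurableTypeR R) R) : Prop :=
  forall n : nat, (0 < n)%N ->
    exists rho : probability (measurableTypeR R) R, is_free_power rho n mu.

Definition sigma_density (R : realType) (a1 a2 x : R) : R :=
  let l := 1 / (Num.sqrt 2 + 1) ^+ 2 in
  let r := 1 / (Num.sqrt 2 - 1) ^+ 2 in
  Num.sqrt ((x - l) * (r - x)) / (2 * pi * x) *
  (a1 / x + a2 / x ^+ 2) * \1_(`]l, r[%classic) x.

Definition has_distribution_sigma (R : realType) (a1 a2 : R)
    (P : probability (measurableTypeR R) R) : Prop :=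
  forall A : set (measurableTypeR R), measurable A ->
    P A = (\int[lebesgue_measure]_(x in A) (sigma_density a1 a2 x)%:E)%E.

Definition inversion (R : realType) (x : measurableTypeR R) : measurableTypeR R := (x : R)^-1.

Lemma measurable_inversion (R : realType) :
  measurable_fun [set: measurableTypeR R] (@inversion R).
Proof.
have E : [set: R] = [set x : R | x != 0] `|` [set 0].
  apply/seteqP; split => // x _; case: (eqVneq x 0) => [->|]; first by right.
  by left.
have o : open [set x : R | x != 0] by exact: open_neq.
rewrite E; apply/measurable_funU => //; first exact: open_measurable.
split.
  apply: open_continuous_measurable_fun => // x /=.
  by rewrite inE => /= x0; exact: inv_continuous.
exact: measurable_fun_set1.
Qed.

HB.instance Definition _ (R : realType) :=
  @isMeasurableFun.Build _ _ (measurableTypeR R) (measurableTypeR R)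
    (@inversion R) (@measurable_inversion R).

(* Main.v *)
Require Import Defs.
From HB Require Import structures.
From mathcomp Require Import all_boot all_order all_algebra complex.
From mathcomp Require Import all_classical all_reals all_analysis.
From mathcomp Require Import ring lra measurable_realfun.
Import Order.TTheory GRing.Theory Num.Theory.
Import numFieldNormedType.Exports.
Local Open Scope classical_set_scope.
Local Open Scope ring_scope.
Set Implicit Arguments.
Unset Strict Implicit.
Unset Printing Implicit Defensive.
Local Open Scope complex_scope.


(** Why the theorem holds.  The law mu of 1/X lives on the interval
    [3 - 2 sqrt 2, 3 + 2 sqrt 2], and its Cauchy transform G becomes rational
    in the Joukowski variable v with z = 3 + v + 2 / v: for v small in the
    lower half-plane, G(z) = w with w = v (1 + a2 v) / (v + 2)
    ([inversion_cauchy_transform]).  Partial fractions give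

      1 / w = 2 / v + a1 / (1 + a2 v),
      z - 1 / w = 3 + v - a1 / (1 + a2 v) =: S.

    Here S is the R-transform of mu at w.  Seen as a function of w it has a
    square-root branch point in the open lower half-plane, because
    w = a1 - 2 a2 + a2 u - 2 a1 / u with u = v + 2 is invariant under
    u |-> - 2 a1 / (a2 u), whose fixed points are not real.  The R-transform
    of a freely infinitely divisible law has no such singularity.

    This obstruction can be seen on a single n-fold root rho of mu, without
    the general theory of free infinite divisibility.  Near the apex of the
    cone, G_rho (1 / w + S / n) = w ([free_power_apex]).  As functions of v
    both sides are analytic, so the equation propagates along the segment
    v = t (- 2 - i p), 0 < t <= 1, as long as 1 / w + S / n stays in the upper
    half-plane, which is the case for n > 4 + p^2 ([ray_end]).  Now choose p
    and p' distinct with p p' = 2 a1 / a2: the points - 2 - i p and - 2 - i p'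
    are exchanged by the symmetry above, hence have the same w, but they have
    different z, hence different S.  So G_rho takes the value w at two distinct
    points Z with Im Z > Im (1 / w) / 2.  That is impossible
    ([cauchy_transform_inj]): if G_rho(Z) = w and Im Z > Im (1 / w) / 2, then
    the function x |-> 1 / (Z - x) stays in L^2(rho) so close to its mean w that two
    such functions cannot have a product of mean zero, whereas
    G_rho(Z1) = G_rho(Z2) with Z1 and Z2 distinct forces exactly this.

    The same injectivity identifies the germs at the apex of all right
    inverses of a Cauchy transform, so that the additivity of Voiculescu
    transforms can be iterated.  Analytic continuation is done by hand
    ([continuation]): the integrand is rational in t, repeated division with
    remainder produces its Taylor coefficients together with a geometric bound
    of the remainder that is uniform in x, and such bounds can be integrated. *)

(** * Integrals of bounded complex functions *)

Section bounded_measurable.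
Context d (T : measurableType d) (R : realType).
Variables (mu : {measure set T -> \bar R}) (D : set T).
Hypotheses (mD : measurable D) (muD : (mu D < +oo)%E).
Implicit Types (f g : T -> R) (F G : T -> R[i]).

Definition bounded_mfun f := measurable_fun D f /\ exists M, forall x, D x -> `|f x| <= M.

Lemma bounded_mfun_cst a : bounded_mfun (cst a).
Proof. by split; [exact: measurable_cst|exists `|a|]. Qed.

Lemma bounded_mfunD f g : bounded_mfun f -> bounded_mfun g -> bounded_mfun (fun x => f x + g x).
Proof.
move=> [mf [M hM]] [mg [N hN]]; split; first exact: measurable_funD.
by exists (M + N) => x Dx; rewrite (le_trans (ler_normD _ _))// lerD// (hM, hN).
Qed.

Lemma bounded_mfunM f g : bounded_mfun f -> bounded_mfun g -> bounded_mfun (fun x => f x * g x).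
Proof.
move=> [mf [M hM]] [mg [N hN]]; split; first exact: measurable_funM.
by exists (M * N) => x Dx; rewrite normrM ler_pM// (hM, hN).
Qed.

Lemma bounded_mfunZ c f : bounded_mfun f -> bounded_mfun (fun x => c * f x).
Proof. by apply: bounded_mfunM; exact: bounded_mfun_cst. Qed.

Lemma bounded_mfunN f : bounded_mfun f -> bounded_mfun (fun x => - f x).
Proof.
move=> [mf [M hM]]; split; first exact: measurableT_comp.
by exists M => x Dx; rewrite normrN hM.
Qed.

Lemma bounded_mfunB f g : bounded_mfun f -> bounded_mfun g -> bounded_mfun (fun x => f x - g x).
Proof. by move=> hf hg; apply: bounded_mfunD => //; exact: bounded_mfunN. Qed.

Lemma bounded_mfun_integrable f : bounded_mfun f -> mu.-integrable D (EFin \o f).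
Proof.
move=> [mf [M hM]]; apply: measurable_bounded_integrable => //.
exists M; split; first exact: num_real.
by move=> N MN x Dx; rewrite /= (le_trans (hM _ Dx))// ltW.
Qed.

Definition bounded_cmfun F := bounded_mfun (fun x => complex.Re (F x)) /\ bounded_mfun (fun x => complex.Im (F x)).

Lemma bounded_cmfun_cst c : bounded_cmfun (cst c).
Proof. by split; exact: bounded_mfun_cst. Qed.

Lemma ReD (a b : R[i]) : complex.Re (a + b) = complex.Re a + complex.Re b.
Proof. by case: a b => [? ?] [? ?]. Qed.
Lemma ImD (a b : R[i]) : complex.Im (a + b) = complex.Im a + complex.Im b.
Proof. by case: a b => [? ?] [? ?]. Qed.
Lemma ReM (a b : R[i]) : complex.Re (a * b) =
  complex.Re a * complex.Re b - complex.Im a * complex.Im b.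
Proof. by case: a b => [? ?] [? ?]. Qed.
Lemma ImM (a b : R[i]) : complex.Im (a * b) =
  complex.Re a * complex.Im b + complex.Im a * complex.Re b.
Proof. by case: a b => [? ?] [? ?]. Qed.
Lemma ReN (a : R[i]) : complex.Re (- a) = - complex.Re a.
Proof. by case: a => [? ?]. Qed.
Lemma ImN (a : R[i]) : complex.Im (- a) = - complex.Im a.
Proof. by case: a => [? ?]. Qed.

Lemma bounded_cmfunD F G : bounded_cmfun F -> bounded_cmfun G -> bounded_cmfun (fun x => F x + G x).
Proof.
move=> [Fr Fi] [Gr Gi]; split.
  by under eq_fun do rewrite ReD; exact: bounded_mfunD.
by under eq_fun do rewrite ImD; exact: bounded_mfunD.
Qed.

Lemma bounded_cmfunM F G : bounded_cmfun F -> bounded_cmfun G -> bounded_cmfun (fun x => F x * G x).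
Proof.
move=> [Fr Fi] [Gr Gi]; split.
  by under eq_fun do rewrite ReM; apply: bounded_mfunB; exact: bounded_mfunM.
by under eq_fun do rewrite ImM; apply: bounded_mfunD; exact: bounded_mfunM.
Qed.

Lemma bounded_cmfunZ c F : bounded_cmfun F -> bounded_cmfun (fun x => c * F x).
Proof. by apply: bounded_cmfunM; exact: bounded_cmfun_cst. Qed.

Lemma bounded_cmfunN F : bounded_cmfun F -> bounded_cmfun (fun x => - F x).
Proof.
move=> [Fr Fi]; split.
  by under eq_fun do rewrite ReN; exact: bounded_mfunN.
by under eq_fun do rewrite ImN; exact: bounded_mfunN.
Qed.

Lemma bounded_cmfunB F G : bounded_cmfun F -> bounded_cmfun G -> bounded_cmfun (fun x => F x - G x).
Proof. by move=> hf hg; apply: bounded_cmfunD => //; exact: bounded_cmfunN. Qed.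

Definition cintegral F : R[i] :=
  (\int[mu]_(x in D) complex.Re (F x)) +i* (\int[mu]_(x in D) complex.Im (F x)).

Lemma cintegralD F G : bounded_cmfun F -> bounded_cmfun G -> cintegral (fun x => F x + G x) = cintegral F + cintegral G.
Proof.
move=> [Fr Fi] [Gr Gi]; rewrite /cintegral.
under eq_Rintegral do rewrite ReD.
under [X in _ +i* X]eq_Rintegral do rewrite ImD.
by rewrite !RintegralD//; exact: bounded_mfun_integrable.
Qed.

Lemma cintegralZ c F : bounded_cmfun F -> cintegral (fun x => c * F x) = c * cintegral F.
Proof.
move=> [Fr Fi]; case: c => a b; rewrite /cintegral.
under eq_Rintegral do rewrite ReM.
under [X in _ +i* X]eq_Rintegral do rewrite ImM.
rewrite RintegralB//; first last.
- by apply: bounded_mfun_integrable; apply: bounded_mfunM => //; exact: bounded_mfun_cst.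
- by apply: bounded_mfun_integrable; apply: bounded_mfunM => //; exact: bounded_mfun_cst.
rewrite RintegralD//; first last.
- by apply: bounded_mfun_integrable; apply: bounded_mfunM => //; exact: bounded_mfun_cst.
- by apply: bounded_mfun_integrable; apply: bounded_mfunM => //; exact: bounded_mfun_cst.
by rewrite !RintegralZl//; exact: bounded_mfun_integrable.
Qed.

Lemma cintegralN F : bounded_cmfun F -> cintegral (fun x => - F x) = - cintegral F.
Proof.
by move=> hF; under eq_fun do rewrite -mulN1r; rewrite cintegralZ// mulN1r.
Qed.

Lemma cintegralB F G : bounded_cmfun F -> bounded_cmfun G -> cintegral (fun x => F x - G x) = cintegral F - cintegral G.
Proof. by move=> hF hG; rewrite cintegralD// ?cintegralN//; exact: bounded_cmfunN. Qed.

Lemma cintegral_cst c : cintegral (cst c) = c * (fine (mu D))%:C.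
Proof.
by case: c => a b; rewrite /cintegral !Rintegral_cst//; simpc.
Qed.

Lemma eq_cint F G : {in D, F =1 G} -> cintegral F = cintegral G.
Proof. by move=> FG; rewrite /cintegral; congr (_ +i* _); apply: eq_Rintegral => x xD; rewrite FG. Qed.

Lemma normc_le_ReIm (z : R[i]) : Normc.normc z <= `|complex.Re z| + `|complex.Im z|.
Proof.
case: z => a b /=; rewrite -[leRHS]ger0_norm ?addr_ge0// -sqrtr_sqr ler_sqrt ?sqr_ge0//.
rewrite -[a ^+ 2]real_normK ?num_real// -[b ^+ 2]real_normK ?num_real//.
by have := normr_ge0 a; have := normr_ge0 b; nra.
Qed.

Lemma Re_le_normc (z : R[i]) : `|complex.Re z| <= Normc.normc z.
Proof. by case: z => a b /=; rewrite -sqrtr_sqr ler_sqrt ?addr_ge0 ?sqr_ge0// lerDl sqr_ge0. Qed.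

Lemma Im_le_normc (z : R[i]) : `|complex.Im z| <= Normc.normc z.
Proof. by case: z => a b /=; rewrite -sqrtr_sqr ler_sqrt ?addr_ge0 ?sqr_ge0// lerDr sqr_ge0. Qed.

Lemma Rintegral_bound f M : bounded_mfun f -> (forall x, D x -> `|f x| <= M) ->
  `|\int[mu]_(x in D) f x| <= M * fine (mu D).
Proof.
move=> hf hM; apply: (le_trans (le_normr_Rintegral mD (bounded_mfun_integrable hf))).
rewrite -Rintegral_cst//; apply: le_Rintegral => //.
- apply: bounded_mfun_integrable; case: hf => mf [N hN]; split; first exact: measurableT_comp.
  by exists N => x Dx; rewrite normr_id hN.
- exact/bounded_mfun_integrable/bounded_mfun_cst.
Qed.

Lemma cintegral_bound F M : bounded_cmfun F -> (forall x, D x -> Normc.normc (F x) <= M) ->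
  Normc.normc (cintegral F) <= 2 * (M * fine (mu D)).
Proof.
move=> [Fr Fi] hM; apply: le_trans (normc_le_ReIm _) _; rewrite mulr_natl mulr2n /=.
apply: lerD; apply: Rintegral_bound => // x Dx; apply: le_trans (hM _ Dx).
  exact: Re_le_normc.
exact: Im_le_normc.
Qed.

End bounded_measurable.

(** * Injectivity of Cauchy transforms high in the upper half-plane *)

Section cauchy_kernel.
Variable R : realType.
Implicit Types (z w : R[i]) (x : R).

Lemma ReV z : complex.Re z^-1 =
  complex.Re z / (complex.Re z ^+ 2 + complex.Im z ^+ 2).
Proof. by case: z. Qed.

Lemma ImV z : complex.Im z^-1 =
  - complex.Im z / (complex.Re z ^+ 2 + complex.Im z ^+ 2).
Proof. by case: z => a b /=; rewrite mulNr. Qed.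

Lemma Re_subr z x : complex.Re (z - x%:C) = complex.Re z - x.
Proof. by case: z => a b /=. Qed.

Lemma Im_subr z x : complex.Im (z - x%:C) = complex.Im z.
Proof. by case: z => a b /=; rewrite subr0. Qed.

Lemma Im_neq0 z : complex.Im z != 0 -> z != 0.
Proof. by apply: contraNneq => ->. Qed.

Lemma sqrc_gt0 z : z != 0 -> 0 < complex.Re z ^+ 2 + complex.Im z ^+ 2.
Proof.
case: z => a b; rewrite eq_complex /= negb_and lt0r => /orP ab0.
by rewrite paddr_eq0 ?sqr_ge0// !sqrf_eq0 negb_and addr_ge0 ?sqr_ge0 ?andbT//; apply/orP.
Qed.

Lemma normc_sqr z : Normc.normc z ^+ 2 = complex.Re z ^+ 2 + complex.Im z ^+ 2.
Proof. by case: z => a b /=; rewrite sqr_sqrtr ?addr_ge0 ?sqr_ge0. Qed.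

Lemma normc_ge0 z : 0 <= Normc.normc z.
Proof. by case: z => a b; exact: sqrtr_ge0. Qed.

Lemma normc_gt0 z : z != 0 -> 0 < Normc.normc z.
Proof.
move=> z0; rewrite lt_neqAle normc_ge0 andbT eq_sym.
by apply: contra z0 => /eqP/Normc.eq0_normc ->.
Qed.

Lemma subr_neq0_Im z x : 0 < complex.Im z -> z - x%:C != 0.
Proof. by move=> z0; rewrite Im_neq0// Im_subr gt_eqF. Qed.

Lemma cauchy_kernel_bound z x : 0 < complex.Im z ->
  Normc.normc (z - x%:C)^-1 <= (complex.Im z)^-1.
Proof.
move=> z0; rewrite Normc.normcV lef_pV2 ?posrE// ?normc_gt0 ?subr_neq0_Im//.
by apply: le_trans (Im_le_normc _); rewrite Im_subr ler_norm.
Qed.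

Lemma bounded_cauchy_kernel z D : measurable D -> 0 < complex.Im z ->
  bounded_cmfun D (fun x : measurableTypeR R => (z - x%:C)^-1).
Proof.
move=> mD z0.
have cN : continuous (fun x : R => (complex.Re z - x) ^+ 2 + complex.Im z ^+ 2).
  move=> x; apply: cvgD; last exact: cvg_cst.
  by rewrite expr2; apply: cvgM; apply: cvgB; [exact: cvg_cst|exact: cvg_id|exact: cvg_cst|exact: cvg_id].
have N0 x : (complex.Re z - x) ^+ 2 + complex.Im z ^+ 2 != 0.
  by rewrite gt_eqF// ltr_wpDl ?sqr_ge0// exprn_gt0.
have cV : continuous (fun x : R => ((complex.Re z - x) ^+ 2 + complex.Im z ^+ 2)^-1).
  by move=> x; apply: cvgV; [exact: N0|exact: cN].
split; split.
- under eq_fun do rewrite ReV Re_subr Im_subr.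
  apply: measurable_funTS; apply: continuous_measurable_fun => x.
  apply: cvgM; last exact: cV.
  by apply: cvgB; [exact: cvg_cst|exact: cvg_id].
- exists (complex.Im z)^-1 => x _.
  by apply: le_trans (Re_le_normc _) _; exact: cauchy_kernel_bound.
- under eq_fun do rewrite ImV Re_subr Im_subr.
  apply: measurable_funTS; apply: continuous_measurable_fun => x.
  by apply: cvgM; [exact: cvg_cst|exact: cV].
- exists (complex.Im z)^-1 => x _.
  by apply: le_trans (Im_le_normc _) _; exact: cauchy_kernel_bound.
Qed.

End cauchy_kernel.

Section injectivity.
Variables (R : realType) (mu : probability (measurableTypeR R) R).
Implicit Types (z w : R[i]) (x : R).

Local Notation cintegral := (cintegral mu setT).
Local Notation G := (cauchy_transform mu).

Lemma probability_setT_lty : (mu setT < +oo)%E.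
Proof. by rewrite probability_setT ltry. Qed.

Lemma cintegral_cst1 c : cintegral (cst c) = c.
Proof. by rewrite cintegral_cst// (congr1 fine (probability_setT mu) : fine _ = 1) mulr1. Qed.

(** The resolvent identity: it turns the second moment of the kernel into the
    imaginary part of the first one. *)
Lemma sqr_cauchy_kernel z x : complex.Im z != 0 ->
  complex.Re (z - x%:C)^-1 ^+ 2 + complex.Im (z - x%:C)^-1 ^+ 2 =
  - complex.Im (z - x%:C)^-1 / complex.Im z.
Proof.
move=> y0; rewrite -[in RHS](Im_subr z x).
have : z - x%:C != 0 by rewrite Im_neq0// Im_subr.
rewrite -(Im_subr z x) in y0; move: y0.
case: (z - x%:C) => a b /= b0 /sqrc_gt0/lt0r_neq0 /= h.
by field; rewrite b0 h.
Qed.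

(** For H = 1 / (z - x), the second moment of |H| is - Im w / Im z by the
    resolvent identity, so the variance of H / w depends on z only through
    Im z.  It is less than 1 exactly when Im z > Im (1 / w) / 2. *)
Lemma cauchy_kernel_variance z w : 0 < complex.Im z -> w != 0 -> G z = w ->
  \int[mu]_x (complex.Re ((z - x%:C)^-1 / w - 1) ^+ 2
              + complex.Im ((z - x%:C)^-1 / w - 1) ^+ 2) =
  complex.Im w^-1 / complex.Im z - 1.
Proof.
move=> z0 w0 Gz.
have [hr hi] := bounded_cauchy_kernel measurableT z0.
have nw := sqrc_gt0 w0.
set y := complex.Im z in z0 *.
set A := complex.Re w in nw *; set B := complex.Im w in nw *.
set N := A ^+ 2 + B ^+ 2 in nw *.
have N0 : N != 0 by rewrite gt_eqF.
have y0 : y != 0 by rewrite gt_eqF.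
have E x : complex.Re ((z - x%:C)^-1 / w - 1) ^+ 2
              + complex.Im ((z - x%:C)^-1 / w - 1) ^+ 2 =
    (- (y * N)^-1 - 2 * B / N) * complex.Im (z - x%:C)^-1
    + ((- 2 * A / N) * complex.Re (z - x%:C)^-1 + 1).
  have := sqr_cauchy_kernel x y0.
  case: (z - x%:C)^-1 => p q /= pq.
  rewrite ReD ImD ReM ImM ReV ImV -/A -/B -/N /=.
  transitivity ((p ^+ 2 + q ^+ 2) / N - 2 * (p * A + q * B) / N + 1).
    rewrite /N; field; exact: N0.
  rewrite pq -/y; field; rewrite y0 N0 //.
under eq_Rintegral do rewrite E.
have mT := @measurableT _ (measurableTypeR R).
have bi f (hf : bounded_mfun (@setT (measurableTypeR R)) f) :
  mu.-integrable setT (EFin \o f) := bounded_mfun_integrable mT probability_setT_lty hf.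
have b1 := bounded_mfun_cst (@setT (measurableTypeR R)) (1 : R).
rewrite RintegralD//; first last.
- by apply: bi; apply: bounded_mfunD => //; exact: bounded_mfunZ.
- by apply: bi; exact: bounded_mfunZ.
rewrite RintegralD//; first last.
- exact: bi.
- by apply: bi; exact: bounded_mfunZ.
rewrite !RintegralZl//; try by apply: bi.
rewrite Rintegral_cst// (congr1 fine (probability_setT mu) : fine _ = 1) mulr1.
have -> : \int[mu]_x complex.Im (z - x%:C)^-1 = B by rewrite /B -Gz.
have -> : \int[mu]_x complex.Re (z - x%:C)^-1 = A by rewrite /A -Gz.
rewrite ImV -/A -/B -/N.
transitivity (- B / N / y - 2 * (A ^+ 2 + B ^+ 2) / N + 1); first by field; rewrite y0 N0.
by rewrite -/N; field; rewrite y0 N0.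
Qed.

(** If z1 and z2 are distinct, then G(z1) = G(z2) and the resolvent identity give
    int H1 H2 = 0 for Hi = 1 / (zi - x).  Since both Hi have mean w, the
    covariance of H1 / w and H2 / w is - 1, which two variables of variance less
    than 1 cannot have. *)
Lemma cauchy_transform_inj z1 z2 w : 0 < complex.Im w^-1 ->
  complex.Im w^-1 < 2 * complex.Im z1 -> complex.Im w^-1 < 2 * complex.Im z2 ->
  G z1 = w -> G z2 = w -> z1 = z2.
Proof.
move=> w0 w1 w2 G1 G2; apply/eqP/negPn/negP => z12.
have z1_gt0 : 0 < complex.Im z1 by lra.
have z2_gt0 : 0 < complex.Im z2 by lra.
have wn0 : w != 0 by apply: contraTneq w0 => ->; rewrite invr0 /= ltxx.
have mT := @measurableT _ (measurableTypeR R).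
have bi f (hf : bounded_mfun (@setT (measurableTypeR R)) f) :
  mu.-integrable setT (EFin \o f) := bounded_mfun_integrable mT probability_setT_lty hf.
have k1 := bounded_cauchy_kernel mT z1_gt0.
have k2 := bounded_cauchy_kernel mT z2_gt0.
set h1 := (fun x => _) in k1; set h2 := (fun x => _) in k2.
have h12 : cintegral (fun x => h1 x * h2 x) = 0.
  have : cintegral (fun x => (z2 - z1) * (h1 x * h2 x)) = 0.
    transitivity (cintegral (fun x => h1 x - h2 x)).
      apply: eq_cint => x _; rewrite /h1 /h2.
      have n1 := subr_neq0_Im x z1_gt0; have n2 := subr_neq0_Im x z2_gt0.
      by field; rewrite n1 n2.
    rewrite (cintegralB mT probability_setT_lty k1 k2).
    by rewrite [cintegral h1]G1 [cintegral h2]G2 subrr.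
  rewrite (cintegralZ mT probability_setT_lty _ (bounded_cmfunM k1 k2)) => /eqP.
  by rewrite mulf_eq0 subr_eq0 eq_sym (negPf z12) => /eqP.
have b1 := bounded_cmfun_cst (@setT (measurableTypeR R)) (1 : R[i]).
have k'1 : bounded_cmfun (@setT (measurableTypeR R)) (fun x => h1 x / w) by apply: bounded_cmfunM => //; exact: bounded_cmfun_cst.
have k'2 : bounded_cmfun (@setT (measurableTypeR R)) (fun x => h2 x / w) by apply: bounded_cmfunM => //; exact: bounded_cmfun_cst.
have c1 := bounded_cmfunB k'1 b1; have c2 := bounded_cmfunB k'2 b1.
have c12 : cintegral (fun x => (h1 x / w - 1) * (h2 x / w - 1)) = -1.
  transitivity (cintegral (fun x => w^-2 * (h1 x * h2 x) - (w^-1 * (h1 x + h2 x) - 1))).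
    by apply: eq_cint => x _; field; exact: wn0.
  have kD := bounded_cmfunD k1 k2; have kM := bounded_cmfunM k1 k2.
  rewrite (cintegralB mT probability_setT_lty (bounded_cmfunZ _ kM) (bounded_cmfunB (bounded_cmfunZ _ kD) b1)).
  rewrite (cintegralZ mT probability_setT_lty _ kM) h12 mulr0 (cintegralB mT probability_setT_lty (bounded_cmfunZ _ kD) b1).
  rewrite (cintegralZ mT probability_setT_lty _ kD) (cintegralD mT probability_setT_lty k1 k2) [cintegral h1]G1 [cintegral h2]G2.
  by rewrite [cintegral _]cintegral_cst1; field; exact: wn0.
have v1 := cauchy_kernel_variance z1_gt0 wn0 G1.
have v2 := cauchy_kernel_variance z2_gt0 wn0 G2.
have r1 : complex.Im w^-1 / complex.Im z1 - 1 < 1 by rewrite ltrBlDr ltr_pdivrMr.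
have r2 : complex.Im w^-1 / complex.Im z2 - 1 < 1 by rewrite ltrBlDr ltr_pdivrMr.
move: c12 => /(congr1 (@complex.Re R)) /=.
rewrite -/h1 -/h2.
have bS F : bounded_cmfun (@setT (measurableTypeR R)) F -> bounded_mfun setT
    (fun x : measurableTypeR R => complex.Re (F x) ^+ 2 + complex.Im (F x) ^+ 2).
  by case=> Fr Fi; apply: bounded_mfunD; under eq_fun do rewrite expr2; exact: bounded_mfunM.
have : \int[mu]_x (- 2 * complex.Re ((h1 x / w - 1) * (h2 x / w - 1))) <=
  \int[mu]_x ((complex.Re (h1 x / w - 1) ^+ 2 + complex.Im (h1 x / w - 1) ^+ 2)
   + (complex.Re (h2 x / w - 1) ^+ 2 + complex.Im (h2 x / w - 1) ^+ 2)).
  apply: le_Rintegral => //.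
  - apply: bi; apply: bounded_mfunZ.
    by case: (bounded_cmfunM c1 c2).
  - by apply: bi; apply: bounded_mfunD; exact: bS.
  - move=> x _; rewrite ReM.
    move: (h1 x / w - 1) (h2 x / w - 1) => [a b] [c e] /=.
    by have := sqr_ge0 (a + c); have := sqr_ge0 (b - e); nra.
rewrite RintegralZl//; last by apply: bi; case: (bounded_cmfunM c1 c2).
rewrite RintegralD//; try by apply: bi; exact: bS.
rewrite v1 v2 => le12 E; rewrite E in le12; lra.
Qed.

End injectivity.

(** * Germs of right inverses at the apex, and free powers *)

Section apex.
Variable R : realType.
Implicit Types (w : R[i]) (H : R[i] -> R[i]) (mu nu rho : probability (measurableTypeR R) R).

(** What remains of a right inverse after shrinking the cone.  The
    inequality on Im (H w) is the one that makes the Cauchy transform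
    injective, and thus pins down the values of H. *)
Definition apex_inverse mu (g : R) H := exists2 d : R, 0 < d & forall w, Lambda g d w ->
  [/\ 0 < complex.Im w^-1, complex.Im w^-1 < 2 * complex.Im (H w)
    & cauchy_transform mu (H w) = w].

Lemma LambdaS (g d d' : R) : d <= d' -> Lambda g d `<=` Lambda g d'.
Proof. by move=> dd' w [h1 [h2 h3]]; split => //; split => //; lra. Qed.

Lemma Lambda_Im_inv (g d : R) w : Lambda g d w -> 0 < complex.Im w^-1.
Proof.
move=> [_ [_ w0]]; rewrite ImV divr_gt0 ?oppr_gt0//.
by rewrite sqrc_gt0// Im_neq0// lt_eqF.
Qed.

Lemma Lambda_normc (g d : R) w : 0 < g -> Lambda g d w ->
  Normc.normc w <= (1 + g^-1) * - complex.Im w.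
Proof.
move=> g0 [h1 [_ h3]]; apply: le_trans (normc_le_ReIm w) _.
rewrite (ltr0_norm h3) mulrDl mul1r addrC lerD2l mulrC ler_pdivlMr// mulrC.
exact: ltW.
Qed.

(** In the cone Im (1 / w) is comparable to |1 / w|, so the error
    |H w - 1 / w| = o(|1 / w|) is eventually less than half of it. *)
Lemma right_inverse_apex mu (g d : R) H : 0 < g -> 0 < d ->
  is_cauchy_right_inverse mu g d H -> apex_inverse mu g H.
Proof.
move=> g0 d0 [GH _ H1].
(* |w| <= L |Im w| in the cone; a relative error of 1 / (2 L) suffices. *)
pose L := 1 + g^-1; have L0 : 0 < L by rewrite addr_gt0// invr_gt0.
pose e := (2 * L)^-1; have e0 : 0 < e by rewrite invr_gt0 mulr_gt0.
have eC : 0 < e%:C by rewrite ltcR.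
have [r /= r0 hr] := (nbhs_ballP _ _).1 (H1 _ (nbhsx_ballx (1 : R[i]^o) _ eC)).
have [r' r'0 rE] : exists2 r' : R, 0 < r' & r = r'%:C.
  move: r0 {hr}; case: r => a b; rewrite ltcE /= => /andP[/eqP -> a0].
  by exists a.
exists (Num.min d (r' / L)); first by rewrite lt_min d0 divr_gt0.
move=> w Lw.
have Lw' : Lambda g d w by apply: LambdaS Lw; rewrite ge_min lexx.
have [HI HG] := GH _ Lw'.
split => //; first exact: Lambda_Im_inv Lw.
have nw := Lambda_normc g0 Lw; rewrite -/L in nw.
have [_ [wd w0]] := Lw.
have wn0 : w != 0 by rewrite Im_neq0// lt_eqF.
have wr : Normc.normc w < r'.
  apply: le_lt_trans nw _; rewrite mulrC -ltr_pdivlMr// ltrNl.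
  by apply: le_lt_trans wd; rewrite lerN2 ge_min lexx orbT.
have := hr w; rewrite -ball_normE /= sub0r normrN rE => /(_ _ Lw').
rewrite !normc_def !ltcR -!/(Normc.normc _).
have nE (z : R[i]) : Num.sqrt (complex.Re z ^+ 2 + complex.Im z ^+ 2) = Normc.normc z by case: z.
rewrite !nE => /(_ wr).
set n := Normc.normc w in nw wr.
have n0 : 0 < n by exact: normc_gt0.
have -> : 1 - w * H w = w * (w^-1 - H w) by field.
rewrite Normc.normcM -/n mulrC -ltr_pdivlMr// => lt1.
have := le_lt_trans (Im_le_normc _) lt1.
rewrite ImD ImN ltr_norml => /andP[_].
have : e / n <= complex.Im w^-1 / 2.
  rewrite ImV -normc_sqr -/n /e.
  rewrite -subr_ge0.
  have -> : - complex.Im w / n ^+ 2 / 2 - (2 * L)^-1 / n =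
      (L * - complex.Im w - n) / (2 * L * n ^+ 2) by field; rewrite !gt_eqF.
  by rewrite divr_ge0 ?subr_ge0// !mulr_ge0 ?exprn_ge0// ltW.
lra.
Qed.

Lemma apex_inverse_unique mu g H H' : apex_inverse mu g H -> apex_inverse mu g H' ->
  exists2 d : R, 0 < d & forall w, Lambda g d w -> H w = H' w.
Proof.
move=> [d d0 h] [d' d'0 h']; exists (Num.min d d'); first by rewrite lt_min d0.
move=> w wL.
have [|w1 w2 w3] := h w; first by apply: LambdaS wL; rewrite ge_min lexx.
have [|_ w'2 w'3] := h' w; first by apply: LambdaS wL; rewrite ge_min lexx orbT.
exact: cauchy_transform_inj w1 w2 w'2 w3 w'3.
Qed.

Lemma eq_cauchy_transform mu nu : (forall A, measurable A -> mu A = nu A) ->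
  cauchy_transform mu = cauchy_transform nu.
Proof.
move=> mn; apply/funext => z; rewrite /cauchy_transform /Rintegral.
by congr (_ +i* _); congr fine; apply: eq_measure_integral => A mA _; exact: mn.
Qed.

Lemma free_convolution_apex mu nu rho g : 0 < g -> is_free_convolution mu nu rho ->
  exists Hm Hn Hr, [/\ apex_inverse mu g Hm, apex_inverse nu g Hn, apex_inverse rho g Hr &
   exists2 d : R, 0 < d & forall w, Lambda g d w -> Hr w - w^-1 = (Hm w - w^-1) + (Hn w - w^-1)].
Proof.
move=> g0 /(_ g g0)[d d0 [pm [pn [pr [[Hm im em] [Hn in_ en] [Hr ir er] h]]]]].
exists Hm, Hn, Hr; split; [exact: right_inverse_apex im|exact: right_inverse_apex in_|exact: right_inverse_apex ir|].
exists d => // w wL; have wL' : Lambda g d (w^-1)^-1 by rewrite invrK.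
by have := h _ wL'; rewrite (em _ wL') (en _ wL') (er _ wL') invrK.
Qed.

(** The functions H w - 1 / w are the R-transforms, and free convolution adds
    them; each step of the induction comes with its own right inverses, which
    have to be identified with the previous ones near the apex. *)
Lemma free_power_apex rho n nu g : 0 < g -> is_free_power rho n nu ->
  forall Hr Hn, apex_inverse rho g Hr -> apex_inverse nu g Hn ->
  exists2 d : R, 0 < d & forall w, Lambda g d w -> Hn w - w^-1 = n%:R * (Hr w - w^-1).
Proof.
move=> g0; elim => [mu mr|m nu' mu _ IH nrm] Hr Hm rH mH.
  have [|d d0 h] := @apex_inverse_unique rho g Hm Hr _ rH.
    by case: mH => d d0 h; exists d => // w /h; rewrite (eq_cauchy_transform mr).
  by exists d => // w /h ->; rewrite mul1r.
have [Hn' [Hr' [Hm' [nH' rH' mH' [d1 d10 h1]]]]] := free_convolution_apex g0 nrm.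
have [d2 d20 h2] := IH _ _ rH nH'.
have [d3 d30 h3] := apex_inverse_unique rH rH'.
have [d4 d40 h4] := apex_inverse_unique mH mH'.
exists (Num.min (Num.min d1 d2) (Num.min d3 d4)); first by rewrite !lt_min d10 d20 d30.
move=> w wL.
rewrite h4; last by apply: LambdaS wL; rewrite !ge_min lexx !orbT.
rewrite h1; last by apply: LambdaS wL; rewrite !ge_min lexx.
rewrite h2; last by apply: LambdaS wL; rewrite !ge_min lexx !orbT.
rewrite -h3; last by apply: LambdaS wL; rewrite !ge_min lexx !orbT.
by rewrite -natr1 mulrDl mul1r.
Qed.

(** A first free power carries no analytic data, whence 1 < n. *)
Lemma free_power_apex_exists rho n nu g : 0 < g -> (1 < n)%N -> is_free_power rho n nu ->
  exists Hr Hn, apex_inverse rho g Hr /\ apex_inverse nu g Hn.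
Proof.
move=> g0 n1 fp; case: fp n1 => // m nu' mu _ nrm _.
by have [Hn [Hr [Hm [_ ? ? _]]]] := free_convolution_apex g0 nrm; exists Hr, Hm.
Qed.

End apex.

(** * Taylor expansion of rational functions by division with remainder *)

Section taylor.
Variable R : realType.
Local Notation C := R[i].
Local Notation normc := (@Normc.normc R).
Implicit Types (F D p : {poly C}) (h : C).

Lemma normc_sum n (u : nat -> C) :
  normc (\sum_(i < n) u i) <= \sum_(i < n) normc (u i).
Proof.
elim: n => [|n IH]; first by rewrite !big_ord0 Normc.normc0.
by rewrite !big_ord_recr /=; apply: le_trans (le_normcD _ _) _; rewrite lerD2r.
Qed.

Lemma normcX h n : normc (h ^+ n) = normc h ^+ n.
Proof. by elim: n => [|n IH]; rewrite ?Normc.normc1// !exprS Normc.normcM IH. Qed.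

Lemma normcR (x : R) : normc x%:C = `|x|.
Proof. by rewrite /= expr0n addr0 sqrtr_sqr. Qed.

Lemma normc_horner p d B h : (size p <= d)%N -> (forall i, normc p`_i <= B) ->
  normc h <= 1 -> normc p.[h] <= d%:R * B.
Proof.
move=> sp pB h1; rewrite (horner_coef_wide _ sp).
apply: le_trans (normc_sum d (fun i => p`_i * h ^+ i)) _.
rewrite mulr_natl -[X in _ <= B *+ X]card_ord -sumr_const; apply: ler_sum => i _.
rewrite Normc.normcM normcX -[leRHS]mulr1; apply: ler_pM => //; try exact: normc_ge0.
  by rewrite exprn_ge0// normc_ge0.
by rewrite exprn_ile1// normc_ge0.
Qed.

(** The numerators F_k in F / D = c_0 + c_1 h + ... + c_(k-1) h^(k-1)
    + h^k F_k / D: subtract the constant term of F_k / D and divide by h. *)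
Fixpoint remainder_num F D k : {poly C} :=
  if k is k'.+1 then
    drop_poly 1 (remainder_num F D k' - ((remainder_num F D k')`_0 / D`_0) *: D)
  else F.

Definition taylor_coef F D k := (remainder_num F D k)`_0 / D`_0.

Lemma horner_drop_poly1 p h : p`_0 = 0 -> p.[h] = (drop_poly 1 p).[h] * h.
Proof.
move=> p0; rewrite -[in LHS](poly_take_drop 1 p) hornerD hornerM hornerXn expr1.
suff -> : take_poly 1 p = 0 by rewrite horner0 add0r.
by apply/polyP => -[|i]; rewrite coef_take_poly coef0.
Qed.

Lemma taylor_expansion F D h N : D`_0 != 0 -> D.[h] != 0 ->
  F.[h] / D.[h] = \sum_(k < N) taylor_coef F D k * h ^+ k
                  + h ^+ N * (remainder_num F D N).[h] / D.[h].
Proof.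
move=> D0 Dh; elim: N => [|N ->]; first by rewrite big_ord0 add0r mul1r.
rewrite big_ord_recr /= -addrA; congr (_ + _).
set r := remainder_num F D N; rewrite -/(taylor_coef F D N).
set c := taylor_coef F D N.
have -> : r.[h] = c * D.[h] + (drop_poly 1 (r - c *: D)).[h] * h.
  rewrite -horner_drop_poly1 ?hornerD ?hornerN ?hornerZ; first by rewrite addrC subrK.
  by rewrite coefB coefZ /c /taylor_coef divfK ?subrr.
by rewrite exprSr; field.
Qed.

Lemma size_rem_num F D d k : (size F <= d)%N -> (size D <= d)%N ->
  (size (remainder_num F D k) <= d)%N.
Proof.
move=> sF sD; elim: k => //= k IH; rewrite size_drop_poly.
apply: leq_trans (leq_subr _ _) _.
apply: leq_trans (size_polyD _ _) _; rewrite geq_max IH /= size_polyN.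
exact: leq_trans (size_scale_leq _ _) sD.
Qed.

(** The growth rate 1 + A depends on the ratios of the coefficients of D only,
    which is what makes the expansion uniform over a family of denominators. *)
Lemma remainder_num_bound F D A B k i : D`_0 != 0 -> (forall i, normc F`_i <= B) ->
  (forall i, normc D`_i <= A * normc D`_0) ->
  normc (remainder_num F D k)`_i <= B * (1 + A) ^+ k.
Proof.
move=> D0 FB DA; elim: k i => [|k IH] i; first by rewrite mulr1.
rewrite /= coef_drop_poly coefB coefZ; apply: le_trans (le_normcD _ _) _.
rewrite normcN !Normc.normcM Normc.normcV exprSr mulrA mulrDr mulr1 lerD//.
rewrite -mulrA; apply: ler_pM; [exact: normc_ge0| |exact: IH|].
  by rewrite mulr_ge0 ?invr_ge0 ?normc_ge0.
by rewrite mulrC ler_pdivrMr// normc_gt0.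
Qed.

(** Only Taylor polynomials with a geometric bound of the remainder are used,
    not convergence of a series; this form survives integration. *)
Lemma identity_principle (S : set R) (f : R -> C) (c : nat -> C) (K q e : R) :
  0 <= K -> 0 < q -> 0 < e -> (forall h : R, - e < h < 0 -> S h) ->
  (forall N (h : R), S h -> normc (f h - \sum_(k < N) c k * h%:C ^+ k) <= K * (q * `|h|) ^+ N) ->
  (forall h : R, - e < h < 0 -> f h = 0) ->
  forall h : R, S h -> q * `|h| < 1 -> f h = 0.
Proof.
move=> K0 q0 e0 eS rem f0.
have c0 k : c k = 0.
  elim/ltn_ind: k => k IH; apply/Normc.eq0_normc/eqP; rewrite eq_le normc_ge0 andbT.
  apply/ler_addgt0Pr => eps eps0; rewrite add0r.
  pose K' := K * q ^+ k.+1 + 1.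
  have K'0 : 0 < K' by rewrite ltr_wpDl// mulr_ge0// exprn_ge0// ltW.
  (* The bound at order k + 1 gives |c_k| <= K' |h|, for h of size eps / K'. *)
  pose h := - Num.min (e / 2) (eps / K').
  have m0 : 0 < Num.min (e / 2) (eps / K') by rewrite lt_min !divr_gt0.
  have he : - e < h < 0.
    rewrite oppr_lt0 m0 andbT ltrN2 gt_min; apply/orP; left; lra.
  have := rem k.+1 h (eS _ he); rewrite f0// sub0r normcN big_ord_recr /=.
  rewrite big1 ?add0r => [|i _]; last by rewrite IH// mul0r.
  have ah : `|h| = Num.min (e / 2) (eps / K') by rewrite normrN gtr0_norm.
  rewrite Normc.normcM normcX normcR exprMn [X in _ <= _ * (_ * X)]exprSr !mulrA.
  have hk : 0 < `|h| ^+ k by rewrite exprn_gt0// ah.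
  rewrite mulrAC ler_pM2r// => le1; apply: le_trans le1 _.
  apply: le_trans (_ : K' * `|h| <= _).
    by rewrite ler_wpM2r// lerDl.
  by rewrite mulrC -ler_pdivlMr// ah ge_min lexx orbT.
move=> h Sh qh; apply/Normc.eq0_normc/eqP; rewrite eq_le normc_ge0 andbT.
apply/ler_addgt0Pr => eps eps0; rewrite add0r.
have x0 : 0 <= q * `|h| by rewrite mulr_ge0// ltW.
have /cvgrPdist_lt : K * (q * `|h|) ^+ n @[n --> \oo] --> K * 0.
  by apply: cvgM; [exact: cvg_cst|apply: cvg_expr; rewrite ger0_norm].
move=> /(_ _ eps0)[N _ /(_ N (leqnn N))] /=; rewrite mulr0 sub0r normrN ger0_norm; last first.
  by rewrite mulr_ge0// exprn_ge0.
move=> /ltW; apply: le_trans; have := rem N h Sh.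
by rewrite big1 ?subr0// => i _; rewrite c0 mul0r.
Qed.

End taylor.

(** * Analytic continuation of an identity for a Cauchy transform *)

Section continuation.
Variables (R : realType) (mu : probability (measurableTypeR R) R).
Local Notation C := R[i].
Local Notation normc := (@Normc.normc R).
Local Notation T := (measurableTypeR R).
Local Notation G := (cauchy_transform mu).
Local Notation cintegral := (cintegral mu setT).
Implicit Types (p P Q M N : {poly C}).

Lemma coef_bounded p : exists2 B, 0 <= B & forall i, normc p`_i <= B.
Proof.
exists (\sum_(j < size p) normc p`_j); first by apply: sumr_ge0 => j _; exact: normc_ge0.
move=> i; have [ip|ip] := ltnP i (size p); last first.
  by rewrite nth_default// Normc.normc0; apply: sumr_ge0 => j _; exact: normc_ge0.
by rewrite (bigD1 (Ordinal ip))//= lerDl; apply: sumr_ge0 => j _; exact: normc_ge0.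
Qed.

Lemma cintegral_sum n (u : nat -> T -> C) : (forall k, bounded_cmfun setT (u k)) ->
  bounded_cmfun setT (fun x => \sum_(k < n) u k x) /\
  cintegral (fun x => \sum_(k < n) u k x) = \sum_(k < n) cintegral (u k).
Proof.
move=> hu; have mT := @measurableT _ T.
elim: n => [|n [IH1 IH2]].
  rewrite big_ord0; split.
    by under eq_fun do rewrite big_ord0; exact: bounded_cmfun_cst.
  by rewrite -[RHS](cintegral_cst1 mu); apply: eq_cint => x _; rewrite big_ord0.
rewrite big_ord_recr /= -IH2 -(cintegralD mT (probability_setT_lty mu) IH1 (hu n)); split.
  by under eq_fun do rewrite big_ord_recr; exact: bounded_cmfunD.
by apply: eq_cint => x _; rewrite big_ord_recr.
Qed.

Lemma bounded_remainder_num (F D : T -> {poly C}) (d0 : C) k i :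
  (forall x, (D x)`_0 = d0) ->
  (forall j, bounded_cmfun setT (fun x => (F x)`_j)) -> (forall j, bounded_cmfun setT (fun x => (D x)`_j)) ->
  bounded_cmfun setT (fun x => (remainder_num (F x) (D x) k)`_i).
Proof.
move=> D0 hF hD; elim: k i => [|k IH] i /=; first exact: hF.
under eq_fun do rewrite coef_drop_poly coefB coefZ D0.
apply: bounded_cmfunB => //; apply: bounded_cmfunM => //; apply: bounded_cmfunM => //; exact: bounded_cmfun_cst.
Qed.

(** The integral of F_x(h) / D_x(h) over x inherits the Taylor bounds of the
    integrand, since the constant terms of the D_x agree and the remaining
    coefficients are bounded uniformly in x. *)
Lemma uniform_identity (F D : T -> {poly C}) (d0 : C) (d : nat) (A B : R) :
  d0 != 0 -> (0 < d)%N -> 0 < A -> 0 <= B ->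
  (forall x, (D x)`_0 = d0) ->
  (forall x, (size (F x) <= d)%N) -> (forall x, (size (D x) <= d)%N) ->
  (forall x i, normc (F x)`_i <= B) -> (forall x i, normc (D x)`_i <= A * normc d0) ->
  (forall j, bounded_cmfun setT (fun x => (F x)`_j)) -> (forall j, bounded_cmfun setT (fun x => (D x)`_j)) ->
  exists2 r : R, 0 < r & forall (S : set R) (e : R), 0 < e ->
   (forall h, S h -> (forall x, (D x).[h%:C] != 0) /\
        bounded_cmfun setT (fun x => (F x).[h%:C] / (D x).[h%:C])) ->
   (forall h, - e < h < 0 -> S h /\ cintegral (fun x => (F x).[h%:C] / (D x).[h%:C]) = 0) ->
   forall h, S h -> `|h| < r -> cintegral (fun x => (F x).[h%:C] / (D x).[h%:C]) = 0.
Proof.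
move=> d00 dgt0 A0 B0 D0 sF sD FB DA hF hD.
have mT := @measurableT _ T; have fT := probability_setT_lty mu.
have nd0 : 0 < normc d0 by exact: normc_gt0.
(* For |h| < r1 the nonconstant part of D_x is at most half of its constant
   term. *)
pose r1 := (2 * d%:R * A)^-1.
have dR : 0 < d%:R :> R by rewrite ltr0n.
have r10 : 0 < r1 by rewrite invr_gt0 !mulr_gt0.
pose q := 1 + A; have q0 : 0 < q by rewrite addr_gt0.
pose K := 2 * (d%:R * B * (2 / normc d0)).
have K0 : 0 <= K by rewrite !mulr_ge0 ?invr_ge0// ltW.
have Dlow x (h : R) : `|h| < 1 -> `|h| < r1 -> normc d0 / 2 <= normc (D x).[h%:C].
  move=> h1 hr.
  have E : (D x).[h%:C] = d0 + (drop_poly 1 (D x - d0%:P)).[h%:C] * h%:C.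
    rewrite -horner_drop_poly1; last by rewrite coefB coefC D0 subrr.
    by rewrite hornerD hornerN hornerC addrC subrK.
  have : normc ((drop_poly 1 (D x - d0%:P)).[h%:C] * h%:C) <= normc d0 / 2.
    rewrite Normc.normcM normcR.
    have : normc (drop_poly 1 (D x - d0%:P)).[h%:C] <= d%:R * (A * normc d0).
      apply: normc_horner.
      - rewrite size_drop_poly; apply: leq_trans (leq_subr _ _) _.
        apply: leq_trans (size_polyD _ _) _; rewrite geq_max sD /= size_polyN.
        exact: leq_trans (size_polyC_leq1 _) _.
      - by move=> i; rewrite coef_drop_poly coefB coefC addn1 subr0 DA.
      - by rewrite normcR ltW.
    move=> le1; apply: le_trans (ler_pM (normc_ge0 _) (normr_ge0 _) le1 (ltW hr)) _.
    by rewrite /r1 le_eqVlt; apply/orP; left; apply/eqP; field; rewrite !gt_eqF.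
  have := le_normcD (D x).[h%:C] (- ((drop_poly 1 (D x - d0%:P)).[h%:C] * h%:C)).
  rewrite {1}E addrK normcN; lra.
pose c k := cintegral (fun x => taylor_coef (F x) (D x) k).
have hc k : bounded_cmfun setT (fun x => taylor_coef (F x) (D x) k).
  under eq_fun do rewrite /taylor_coef D0.
  by apply: bounded_cmfunM; [exact: (bounded_remainder_num _ _ D0)|exact: bounded_cmfun_cst].
exists (Num.min (Num.min 1 r1) q^-1).
  by rewrite !lt_min ltr01 r10 invr_gt0.
move=> S e e0 hS he h Sh; rewrite !lt_min => /andP[/andP[h1 hr1] hq].
pose S' := [set h : R | S h /\ `|h| < 1 /\ `|h| < r1].
pose e' := Num.min e (Num.min 1 r1).
have e'0 : 0 < e' by rewrite !lt_min e0 ltr01.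
have ee' (h' : R) : - e' < h' < 0 -> - e < h' < 0 /\ S' h'.
  move=> /andP[]; rewrite ltrNl !lt_min => /andP[a1 /andP[a2 a3]] h'0.
  have a4 : - e < h' < 0 by rewrite ltrNl a1 h'0.
  by split => //; split; [have [] := he _ a4|rewrite ltr0_norm].
apply: (@identity_principle R S' (fun h : R => cintegral (fun x => (F x).[h%:C] / (D x).[h%:C]))
   c K q e') => //.
- by move=> h' /ee' [].
- move=> m h' [Sh' [h'1 h'r]].
  have [Dh' kh'] := hS _ Sh'.
  have ht k : bounded_cmfun setT (fun x => taylor_coef (F x) (D x) k * h'%:C ^+ k).
    by apply: bounded_cmfunM => //; exact: bounded_cmfun_cst.
  have cE k : c k * h'%:C ^+ k = cintegral (fun x => taylor_coef (F x) (D x) k * h'%:C ^+ k).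
    rewrite mulrC -(cintegralZ mT fT _ (hc k)); apply: eq_cint => x _; exact: mulrC.
  have [s1 s2] := cintegral_sum m ht.
  under eq_bigr do rewrite cE.
  rewrite -s2 -(cintegralB mT fT kh' s1).
  apply: le_trans (cintegral_bound mT fT (M := d%:R * B * (2 / normc d0) * (q * `|h'|) ^+ m) (bounded_cmfunB kh' s1) _) _.
    move=> x _; rewrite (taylor_expansion _ m _ (Dh' x)) ?D0//.
    rewrite addrAC subrr add0r !Normc.normcM Normc.normcV normcX normcR.
    have b1 : normc (remainder_num (F x) (D x) m).[h'%:C] <= d%:R * (B * q ^+ m).
      apply: normc_horner; first exact: size_rem_num.
        by move=> i; apply: remainder_num_bound; rewrite ?D0.
      by rewrite normcR ltW.
    have b2 : (normc (D x).[h'%:C])^-1 <= 2 / normc d0.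
      rewrite -[leRHS]invrK lef_pV2 ?posrE ?normc_gt0//; last first.
        by rewrite invr_gt0 divr_gt0.
      by rewrite invf_div Dlow.
    have i0 : 0 <= (normc (D x).[h'%:C])^-1 by rewrite invr_ge0 normc_ge0.
    apply: le_trans (_ : _ <= `|h'| ^+ m * (d%:R * (B * q ^+ m) * (2 / normc d0))) _.
      by rewrite -mulrA; apply: ler_wpM2l; [rewrite exprn_ge0|apply: ler_pM => //; exact: normc_ge0].
    rewrite exprMn.
    by rewrite le_eqVlt; apply/orP; left; apply/eqP; ring.
  by rewrite (congr1 fine (probability_setT mu) : fine _ = 1) mulr1 /K !mulrA.
- by move=> h' /ee' [/he [_ ->]].
- by rewrite mulrC -ltr_pdivlMr// mul1r.
Qed.

Definition quotient_in_uhp P Q (t : R) := Q.[t%:C] != 0 /\ 0 < complex.Im (P.[t%:C] / Q.[t%:C]).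

(** With Z0 the value of P / Q at t0 and y = 1 / (Z0 - x), the kernel
    1 / (P / Q - x) is y Q / D where D = (P - Z0 Q) y + Q.  The coefficients of D
    are affine in the bounded function y, and its value at t0 is that of Q,
    independently of x: this is the situation of [uniform_identity]. *)
Lemma local_continuation P Q N M (t0 : R) : quotient_in_uhp P Q t0 ->
  exists2 r : R, 0 < r & forall e : R, 0 < e ->
   (forall t, t0 - e < t < t0 -> quotient_in_uhp P Q t /\ N.[t%:C] * G (P.[t%:C] / Q.[t%:C]) = M.[t%:C]) ->
   forall t, quotient_in_uhp P Q t -> `|t - t0| < r -> N.[t%:C] * G (P.[t%:C] / Q.[t%:C]) = M.[t%:C].
Proof.
move=> [Q0 Z0_gt0]; set Z0 := P.[t0%:C] / Q.[t0%:C] in Z0_gt0.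
have mT := @measurableT _ T; have fT := probability_setT_lty mu.
pose sh p := p \Po ('X + t0%:C%:P).
have shE p h : (sh p).[h] = p.[h + t0%:C] by rewrite horner_comp !hornerE.
have sh0 p : (sh p)`_0 = p.[t0%:C] by rewrite -horner_coef0 shE add0r.
pose y (x : T) := (Z0 - x%:C)^-1.
(* The integrand N / (P / Q - x) - M is F / D in the variable h = t - t0. *)
pose rr := sh P - Z0 *: sh Q.
pose f1 := sh N * sh Q - sh M * rr; pose f2 := - (sh M * sh Q).
pose D x := y x *: rr + sh Q; pose F x := y x *: f1 + f2.
have [B1 B10 hB1] := coef_bounded rr; have [B2 B20 hB2] := coef_bounded (sh Q).
have [B3 B30 hB3] := coef_bounded f1; have [B4 B40 hB4] := coef_bounded f2.
pose I := (complex.Im Z0)^-1; have I0 : 0 < I by rewrite invr_gt0.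
have hy x : normc (y x) <= I by exact: cauchy_kernel_bound.
have coefb (a b : {poly C}) A1 A2 x i : (forall i, normc a`_i <= A1) -> (forall i, normc b`_i <= A2) ->
    normc (y x *: a + b)`_i <= I * A1 + A2.
  move=> ha hb; rewrite coefD coefZ; apply: le_trans (le_normcD _ _) _.
  by rewrite lerD// Normc.normcM ler_pM ?normc_ge0.
have n0 : 0 < normc Q.[t0%:C] by exact: normc_gt0.
have hk j (a b : {poly C}) : bounded_cmfun setT (fun x => (y x *: a + b)`_j).
  under eq_fun do rewrite coefD coefZ.
  by apply: bounded_cmfunD; [apply: bounded_cmfunM; [exact: bounded_cauchy_kernel|]|]; exact: bounded_cmfun_cst.
pose d := (maxn (maxn (size rr) (size (sh Q))) (maxn (size f1) (size f2))).+1.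
have sz (a b : {poly C}) x : (size a <= d)%N -> (size b <= d)%N -> (size (y x *: a + b)%R <= d)%N.
  move=> sa sb; apply: leq_trans (size_polyD _ _) _; rewrite geq_max sb andbT.
  exact: leq_trans (size_scale_leq _ _) sa.
have [] := @uniform_identity F D Q.[t0%:C] d ((I * B1 + B2 + 1) / normc Q.[t0%:C]) (I * B3 + B4).
- exact: Q0.
- by [].
- by rewrite divr_gt0// ltr_wpDl// addr_ge0// mulr_ge0// ltW.
- by rewrite addr_ge0// mulr_ge0// ltW.
- move=> x; rewrite coefD coefZ coefB coefZ !sh0 divfK//.
  by rewrite subrr mulr0 add0r.
- by move=> x; apply: sz; rewrite leqW// !leq_max leqnn !orbT.
- by move=> x; apply: sz; rewrite leqW// !leq_max leqnn ?orbT.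
- by move=> x i; exact: coefb.
- by move=> x i; rewrite divfK ?gt_eqF//; apply: ler_wpDr => //; exact: coefb.
- by move=> j; exact: hk.
- by move=> j; exact: hk.
move=> r r0 hr; exists r => // e e0 he.
pose S := [set h : R | quotient_in_uhp P Q (h + t0)].
have DE h x : quotient_in_uhp P Q (h + t0) -> (D x).[h%:C] =
    y x * Q.[(h + t0)%:C] * (P.[(h + t0)%:C] / Q.[(h + t0)%:C] - x%:C).
  move=> [q0 z0].
  rewrite hornerD hornerZ hornerD hornerN hornerZ !shE -raddfD /=.
  have := subr_neq0_Im x Z0_gt0; rewrite /y; move: (Z0) => Z h0.
  by field; rewrite h0 q0.
have D0 h x : quotient_in_uhp P Q (h + t0) -> (D x).[h%:C] != 0.
  move=> Zh; rewrite DE//; case: Zh => q0 z0.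
  by rewrite !mulf_neq0// ?invr_neq0// subr_neq0_Im.
have FDE h x : quotient_in_uhp P Q (h + t0) -> (F x).[h%:C] / (D x).[h%:C] =
    N.[(h + t0)%:C] * (P.[(h + t0)%:C] / Q.[(h + t0)%:C] - x%:C)^-1 - M.[(h + t0)%:C].
  move=> Zh; have D0h := D0 h x Zh; have DEh := DE h x Zh.
  apply: (mulIf D0h); rewrite divfK//.
  have -> : (F x).[h%:C] = y x * (N.[(h + t0)%:C] * Q.[(h + t0)%:C]) - M.[(h + t0)%:C] * (D x).[h%:C].
    rewrite /F /D /f1 /f2 !(hornerD, hornerN, hornerZ, hornerM) !shE -raddfD /=.
    ring.
  rewrite mulrBl; congr (_ - _); rewrite DEh; case: Zh => q0 z0.
  have := subr_neq0_Im x z0; move: (P.[_] / _) => Z h0.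
  by field.
have kb h : quotient_in_uhp P Q (h + t0) -> bounded_cmfun setT (fun x : T =>
    (P.[(h + t0)%:C] / Q.[(h + t0)%:C] - x%:C)^-1).
  by move=> [_ z0]; exact: bounded_cauchy_kernel.
have kc c : bounded_cmfun (@setT T) (fun=> c : C) by exact: bounded_cmfun_cst.
have iE h : quotient_in_uhp P Q (h + t0) -> cintegral (fun x => (F x).[h%:C] / (D x).[h%:C]) =
    N.[(h + t0)%:C] * G (P.[(h + t0)%:C] / Q.[(h + t0)%:C]) - M.[(h + t0)%:C].
  move=> Zh; under eq_cint do rewrite FDE//.
  rewrite (cintegralB mT fT (bounded_cmfunZ _ (kb h Zh)) (kc _)) (cintegralZ mT fT _ (kb h Zh)).
  by rewrite [X in _ - X](cintegral_cst1 mu).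
move=> t Zt tr.
have tt0 : t = (t - t0) + t0 by rewrite subrK.
apply/eqP; rewrite -subr_eq0 tt0; rewrite tt0 in Zt; rewrite -iE//; apply/eqP.
apply: (hr S e) => //.
- move=> h Sh; split; first by move=> x; exact: D0.
  under eq_fun do rewrite FDE//.
  by apply: bounded_cmfunB => //; apply: bounded_cmfunZ; exact: kb.
- move=> h /andP[h1 h2]; have [|Zh idh] := he (h + t0).
    by apply/andP; split; lra.
  by split => //; rewrite iE// idh subrr.
Qed.

(** The supremum of the s such that the identity holds on (0, s] is attained and
    equal to 1 by local continuation from the left. *)
Lemma continuation P Q N M (tau : R) : 0 < tau ->
  (forall t, 0 < t <= 1 -> quotient_in_uhp P Q t) ->
  (forall t, 0 < t <= 1 -> t < tau -> N.[t%:C] * G (P.[t%:C] / Q.[t%:C]) = M.[t%:C]) ->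
  N.[1%:C] * G (P.[1%:C] / Q.[1%:C]) = M.[1%:C].
Proof.
move=> tau0 dom idt.
pose ok (t : R) := N.[t%:C] * G (P.[t%:C] / Q.[t%:C]) = M.[t%:C].
pose U := [set s : R | 0 < s <= 1 /\ forall t, 0 < t <= s -> ok t].
have Uub : ubound U 1 by move=> s [/andP[]].
pose s0 := Num.min 1 (tau / 2).
have s00 : 0 < s0 by rewrite lt_min ltr01 divr_gt0.
have Us0 : U s0.
  split; first by rewrite s00 ge_min lexx.
  move=> t /andP[t0]; rewrite le_min => /andP[t1 t2].
  by apply: idt; [rewrite t0|lra].
have hU : has_sup U by split; [exists s0|exists 1].
pose s := sup U.
have s0s : s0 <= s by exact: sup_upper_bound.
have sgt0 : 0 < s by exact: lt_le_trans s0s.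
have s1 : s <= 1 by apply: sup_le_ub => //; exists s0.
have oks t : 0 < t < s -> ok t.
  move=> /andP[t0 ts].
  have st0 : 0 < s - t by rewrite subr_gt0.
  have [u Uu tu] := sup_adherent st0 hU.
  by case: Uu => _; apply; rewrite t0 ltW//; move: tu; rewrite -/s; lra.
have [r r0 hr] := local_continuation N M (dom s (introT andP (conj sgt0 s1))).
have okr t : 0 < t <= 1 -> `|t - s| < r -> ok t.
  move=> t01; apply: (hr s) => //; last exact: dom.
  move=> t'; rewrite subrr => t's; split; last exact: oks.
  by apply: dom; case/andP: t's => -> /ltW/le_trans; exact.
pose s' := Num.min 1 (s + r / 2).
have Us' : U s'.
  split; first by rewrite lt_min ltr01 /= addr_gt0 ?divr_gt0// ge_min lexx.
  move=> t /andP[t0]; rewrite le_min => /andP[t1 t2].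
  have [ts|st] := ltP t s; first by apply: oks; rewrite t0.
  by apply: okr; rewrite ?t0// ger0_norm ?subr_ge0//; lra.
have : s' <= s by exact: sup_upper_bound.
rewrite ge_min => /orP[s1'|?]; last by exfalso; lra.
have ok1 : ok 1 by case: Us' => _; apply; rewrite ltr01 le_min lexx /=; lra.
exact: ok1.
Qed.

End continuation.

(** * Trigonometric integrals *)

Section calculus.
Variable R : realType.

Lemma Rintegral_FTC (f F : R -> R) (a b : R) : a < b -> continuous f ->
  (forall x : R, is_derive x 1 F (f x)) ->
  \int[lebesgue_measure]_(x in `[a, b]) f x = F b - F a.
Proof.
move=> ab cf dF.
have cF : continuous F.
  by move=> x; apply: differentiable_continuous; apply/derivable1_diffP; have := dF x; case.
rewrite /Rintegral (@continuous_FTC2 _ f F)//.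
- exact: continuous_subspaceT.
- split; first by move=> x _; have := dF x; case.
  + by apply: cvg_at_right_filter; exact: cF.
  + by apply: cvg_at_left_filter; exact: cF.
- by move=> x _; rewrite derive1E; have := dF x => -[].
Qed.

Lemma is_derive_mulr (m x : R) : is_derive x 1 ( *%R m) m.
Proof.
have -> : ( *%R m) = m *: (@id R) by apply/funext => y.
by apply: is_derive_eq; rewrite /GRing.scale /= mulr1.
Qed.

Lemma is_derive_sinM (m x : R) : is_derive x 1 (fun t => sin (m * t)) (m * cos (m * x)).
Proof.
have := is_derive_mulr m x => h.
have h2 := @is_derive1_comp R sin ( *%R m) x _ _ (is_derive_sin (m * x)) h.
by apply: (is_derive_eq h2); rewrite mulrC.
Qed.

Lemma is_derive_cosM (m x : R) : is_derive x 1 (fun t => cos (m * t)) (- (m * sin (m * x))).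
Proof.
have := is_derive_mulr m x => h.
have h2 := @is_derive1_comp R cos ( *%R m) x _ _ (is_derive_cos (m * x)) h.
by apply: (is_derive_eq h2); rewrite mulrC mulrN.
Qed.

Lemma sin_natpi n : sin (n%:R * pi) = 0 :> R.
Proof. by elim: n => [|n IH]; rewrite ?mul0r ?sin0// -natr1 mulrDl mul1r sinDpi IH oppr0. Qed.

Lemma continuous_sinM (m : R) : continuous (fun t => sin (m * t)).
Proof.
move=> x; apply: (@continuous_comp _ _ _ ( *%R m) sin); first exact: mulrl_continuous.
exact: continuous_sin.
Qed.

Lemma integral_sin_sin n :
  \int[lebesgue_measure]_(t in `[0, pi]) (sin t * sin (n.+1%:R * t)) =
  (if n == 0%N then pi / 2 else 0) :> R.
Proof.
have cc m : continuous (fun t : R => sin t * sin (m * t)).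
  by move=> x; apply: cvgM; [exact: continuous_sin|exact: continuous_sinM].
case: eqVneq => [->|n0].
  pose F := (2^-1 : R) *: ((@id R) - (@sin R) * (@cos R)).
  have dF : forall x : R, is_derive x 1 F (sin x * sin (1 * x)).
    move=> x.
    rewrite /F; apply: is_derive_eq; rewrite /GRing.scale /= mul1r.
    have -> : cos x * cos x = 1 - sin x ^+ 2 by rewrite -(cos2Dsin2 x); ring.
    by field.
  rewrite (Rintegral_FTC (pi_gt0 R) (cc _) dF).
  by rewrite /F /= !fctE sinpi sin0 /GRing.scale /=; field.
pose m : R := n.+1%:R.
have m1 : m ^+ 2 - 1 != 0.
  rewrite subr_sqr_1 mulf_neq0//; first by rewrite /m -natr1 addrK pnatr_eq0.
  by rewrite /m natr1 pnatr_eq0.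
pose F := ((m ^+ 2 - 1)^-1 : R) *: ((@cos R) * (fun t => sin (m * t)) - m *: ((@sin R) * (fun t => cos (m * t)))).
have dF : forall x : R, is_derive x 1 F (sin x * sin (m * x)).
  move=> x.
  have h1 := is_derive_sinM m x; have h2 := is_derive_cosM m x.
  rewrite /F; apply: is_derive_eq; rewrite /GRing.scale /=; field; rewrite nat1r; exact: m1.
rewrite (Rintegral_FTC (pi_gt0 R) (cc _) dF).
rewrite /F /= !fctE sinpi !mulr0 sin0 /m sin_natpi.
by rewrite /GRing.scale /= !(mul0r, mulr0, subr0).
Qed.

End calculus.

(** * A Poisson-type integral with a complex parameter *)

Section bounded_inverse.
Context d (T : measurableType d) (R : realType) (D : set T).

Lemma bounded_cmfun_inv (F : T -> R[i]) (k : R) : 0 < k -> bounded_cmfun D F ->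
  (forall x, D x -> k <= Normc.normc (F x)) -> bounded_cmfun D (fun x => (F x)^-1).
Proof.
move=> k0 [[mr _] [mi _]] hk.
have mN : measurable_fun D (fun x => (complex.Re (F x) ^+ 2 + complex.Im (F x) ^+ 2)^-1).
  apply: (measurableT_comp (@measurable_inversion R)).
  by apply: measurable_funD; exact: measurable_funX.
have ub x : D x -> Normc.normc (F x)^-1 <= k^-1.
  by move=> Dx; rewrite Normc.normcV lef_pV2 ?hk// posrE (lt_le_trans k0)// hk.
split; split.
- by under eq_fun do rewrite ReV; exact: measurable_funM.
- by exists k^-1 => x Dx; apply: le_trans (Re_le_normc _) _; exact: ub.
- under eq_fun do rewrite ImV; apply: measurable_funM => //.
  exact: measurableT_comp.
- by exists k^-1 => x Dx; apply: le_trans (Im_le_normc _) _; exact: ub.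
Qed.

Lemma bounded_cmfun_real (f : T -> R) : bounded_mfun D f -> bounded_cmfun D (fun x => (f x)%:C).
Proof. by move=> hf; split => //; exact: bounded_mfun_cst. Qed.

End bounded_inverse.

Lemma bounded_mfun_continuous (R : realType) (f : R -> R) (a b : R) : continuous f ->
  bounded_mfun (`[a, b]%classic : set (measurableTypeR R)) f.
Proof.
move=> cf; split.
  by apply: measurable_funTS; exact: continuous_measurable_fun.
have : compact (f @` `[a, b]).
  by apply: continuous_compact; [exact: continuous_subspaceT|exact: segment_compact].
move=> /compact_bounded[M [_ hM]]; exists (M + 1) => x xab.
by apply: hM; [rewrite ltrDl|exists x].
Qed.

Section poisson.
Variable R : realType.
Local Notation C := R[i].
Local Notation T := (measurableTypeR R).
Local Notation lambda := (@lebesgue_measure R).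
Local Notation I := (`[0, pi]%classic : set T).
Local Notation cintegral := (cintegral lambda I).

(** Equal to (1 - s e^(i t)) (1 - s e^(- i t)); its inverse is the generating
    function of the Chebyshev polynomials of the second kind at cos t. *)
Definition chebyshev_denom (s : C) (t : R) : C := 1 - 2 * s * (cos t)%:C + s ^+ 2.

Lemma lebesgue_0pi_lty : (lambda I < +oo)%E.
Proof. by rewrite lebesgue_measure_itv /= lte_fin pi_gt0 -EFinB ltry. Qed.

Lemma measurable_0pi : measurable I.
Proof. exact: measurable_itv. Qed.

Lemma bounded_chebyshev_denom s : bounded_cmfun I (chebyshev_denom s).
Proof.
have h : bounded_cmfun I (fun t => (cos t)%:C).
  by apply: bounded_cmfun_real; apply: bounded_mfun_continuous; exact: continuous_cos.
apply: bounded_cmfunD; last exact: bounded_cmfun_cst.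
by apply: bounded_cmfunB; [exact: bounded_cmfun_cst|exact: bounded_cmfunZ].
Qed.

(** With A_n the integral of sin t sin (n t) / chebyshev_denom s t, the addition
    formula gives s (A_(n+2) + A_n) = (1 + s^2) A_(n+1) for n > 0, that is,
    B_n = s B_(n+1) for B_n = A_(n+1) - s A_n.  The A_n are bounded and |s| < 1,
    so B_1 = s^n B_(n+1) vanishes; the recurrence at n = 0, where the integral of
    sin^2 enters, then reads A_1 = pi / 2. *)
Lemma sine_integral (s : C) (k : R) : Normc.normc s < 1 -> 0 < k ->
  (forall t, I t -> k <= Normc.normc (chebyshev_denom s t)) ->
  cintegral (fun t => (sin t ^+ 2)%:C / chebyshev_denom s t) = (pi / 2)%:C.
Proof.
move=> s1 k0 hk.
pose ss n (t : R) := sin t * sin (n%:R * t).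
have css n : continuous (ss n).
  by move=> x; apply: cvgM; [exact: continuous_sin|exact: continuous_sinM].
have hss n : bounded_cmfun I (fun t => (ss n t)%:C).
  by apply: bounded_cmfun_real; exact: bounded_mfun_continuous.
have den0 t : I t -> chebyshev_denom s t != 0.
  by move=> /hk; apply: contraTneq => ->; rewrite Normc.normc0 -ltNge.
have hinv : bounded_cmfun I (fun t => (chebyshev_denom s t)^-1) := bounded_cmfun_inv k0 (bounded_chebyshev_denom s) hk.
pose A n := cintegral (fun t => (ss n t)%:C / chebyshev_denom s t).
have hA n : bounded_cmfun I (fun t => (ss n t)%:C / chebyshev_denom s t) by exact: bounded_cmfunM.
have A0 : A 0%N = 0.
  rewrite /A -[RHS](mul0r ((fine (lambda I))%:C)) -(cintegral_cst lambda measurable_0pi).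
  by apply: eq_cint => t _; rewrite /ss mul0r sin0 mulr0 mul0r.
have rec n : s * (A n.+2 + A n) = (1 + s ^+ 2) * A n.+1 - (if n == 0%N then pi / 2 else 0)%:C.
  have -> : (if n == 0%N then pi / 2 else 0)%:C = cintegral (fun t => (ss n.+1 t)%:C).
    rewrite -integral_sin_sin /cintegral /=; congr (_ +i* _).
    by rewrite Rintegral_cst ?mul0r//; exact: measurable_0pi.
  rewrite -(cintegralD measurable_0pi lebesgue_0pi_lty (hA _) (hA _)) -(cintegralZ measurable_0pi lebesgue_0pi_lty _ (bounded_cmfunD (hA _) (hA _))).
  rewrite -(cintegralZ measurable_0pi lebesgue_0pi_lty _ (hA _)) -(cintegralB measurable_0pi lebesgue_0pi_lty (bounded_cmfunZ _ (hA _)) (hss _)).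
  apply: eq_cint => t /[1!inE] It; have d0 := den0 t It.
  have E : ss n.+2 t + ss n t = 2 * cos t * ss n.+1 t.
    have -> : ss n.+2 t = sin t * sin (n.+1%:R * t + t).
      by rewrite /ss -[n.+2%:R]natr1 mulrDl mul1r.
    have -> : ss n t = sin t * sin (n.+1%:R * t - t).
      by rewrite /ss -[n.+1%:R]natr1 mulrDl mul1r addrK.
    by rewrite !sinD cosN sinN /ss; ring.
  have -> : (ss n.+2 t)%:C = (2 * cos t * ss n.+1 t)%:C - (ss n t)%:C by rewrite -E rmorphD /= addrK.
  rewrite !rmorphM /= rmorph_nat; move: d0; rewrite /chebyshev_denom => d0; field; exact: d0.
pose B n := A n.+1 - s * A n.
have recB n : (0 < n)%N -> B n = s * B n.+1.
  case: n => // n _; have := rec n.+1; rewrite /= subr0 /B => h.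
  have -> : s * (A n.+3 - s * A n.+2) = s * (A n.+3 + A n.+1) - s ^+ 2 * A n.+2 - s * A n.+1 by ring.
  by rewrite h; ring.
have powB n : B 1%N = s ^+ n * B n.+1.
  elim: n => [|n ->]; first by rewrite mul1r.
  by rewrite recB// exprSr mulrA.
pose M := 2 * (k^-1 * fine (lambda I)).
have lI0 : 0 <= fine (lambda I) by exact: fine_ge0.
have Ab n : Normc.normc (A n) <= M.
  apply: (cintegral_bound measurable_0pi lebesgue_0pi_lty (hA n)) => t It.
  rewrite Normc.normcM normcR Normc.normcV -[leRHS]mul1r ler_pM ?invr_ge0 ?normc_ge0//.
    by rewrite /ss normrM mulr_ile1// ler_norml ?sin_geN1 ?sin_le1.
  by rewrite lef_pV2 ?hk// posrE (lt_le_trans k0)// hk.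
have M0 : 0 <= M := le_trans (normc_ge0 _) (Ab 0%N).
have Bb n : Normc.normc (B n) <= M + M.
  apply: le_trans (le_normcD _ _) _; rewrite normcN Normc.normcM lerD//.
  by rewrite -[leRHS]mul1r ler_pM ?normc_ge0// ltW.
have B1 : B 1%N = 0.
  apply/Normc.eq0_normc/eqP; rewrite eq_le normc_ge0 andbT.
  apply/ler_addgt0Pr => eps eps0; rewrite add0r.
  have /cvgrPdist_lt : Normc.normc s ^+ n * (M + M) @[n --> \oo] --> 0 * (M + M).
    by apply: cvgM; [apply: cvg_expr; rewrite ger0_norm ?normc_ge0|exact: cvg_cst].
  move=> /(_ _ eps0)[N _ /(_ N (leqnn N))] /=; rewrite mul0r sub0r normrN ger0_norm; last first.
    by rewrite mulr_ge0 ?exprn_ge0 ?normc_ge0// addr_ge0.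
  move=> /ltW; apply: le_trans; rewrite (powB N) Normc.normcM normcX.
  by rewrite ler_wpM2l ?exprn_ge0 ?normc_ge0.
have := rec 0%N; rewrite /= A0 addr0.
have -> : A 2%N = s * A 1%N by apply/eqP; rewrite -subr_eq0; apply/eqP.
move=> h.
have A1 : A 1%N = (pi / 2)%:C.
  apply/eqP; rewrite -subr_eq0; apply/eqP.
  transitivity ((1 + s ^+ 2) * A 1%N - (pi / 2)%:C - s * (s * A 1%N)); first by ring.
  by rewrite -h subrr.
by rewrite -A1; apply: eq_cint => t _; rewrite /ss mul1r expr2.
Qed.

End poisson.

(** * The law of the inverse in trigonometric coordinates *)

Section density.
Variable R : realType.
Local Notation T := (measurableTypeR R).
Local Notation lambda := (@lebesgue_measure R).

Lemma Rintegral_density (P : probability T R) (f g : T -> R) :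
  measurable_fun setT f ->
  (forall A, measurable A -> P A = (\int[lambda]_(x in A) (f x)%:E)%E) ->
  P.-integrable setT (EFin \o g) ->
  \int[P]_x g x = \int[lambda]_x (g x * f x).
Proof.
move=> mf Pf ig; rewrite /Rintegral; congr fine.
have dom : P `<< lambda.
  apply/null_content_dominatesP => A mA A0; rewrite Pf//.
  by rewrite null_set_integral//; apply/measurable_EFinP; exact: measurable_funTS.
rewrite -(Radon_Nikodym_change_of_variables dom measurableT ig).
apply: ae_eq_integral => //.
- by apply: emeasurable_funM => //; exact: (measurable_int P).
- apply/measurable_EFinP; apply: measurable_funM => //.
  by apply/measurable_EFinP; exact: (measurable_int P).
- rewrite (_ : (fun x => (g x * f x)%:E) = ((EFin \o g) \* (EFin \o f))%E)//.
  apply: ae_eqe_mul2l => /=.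
  apply: integral_ae_eq => //=.
  + apply: Radon_Nikodym_integrable; exact: dom.
  + exact/measurable_EFinP.
  + move=> E _ mE; rewrite -Radon_Nikodym_integral//=; exact: Pf.
Qed.

Lemma Rintegral_distribution (P : probability T R) (X : {mfun T >-> T}) (g : T -> R) :
  bounded_mfun setT g ->
  \int[distribution P X]_x g x = \int[P]_x g (X x).
Proof.
move=> [mg [M hM]]; rewrite /Rintegral; congr fine.
rewrite (@integral_pushforward _ _ _ _ _ X _ P setT (EFin \o g))//.
- exact/measurable_EFinP.
- rewrite preimage_setT; apply: (bounded_mfun_integrable (mu := P) measurableT (probability_setT_lty P)).
  by split; [exact: measurableT_comp|exists M => x _; exact: hM].
Qed.

End density.

Section sigma.
Variable R : realType.
Local Notation T := (measurableTypeR R).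
Local Notation lambda := (@lebesgue_measure R).
Local Notation q := (Num.sqrt 2 : R).

(** The points of the support of the law of 1 / X, which is centred at 3 with
    half-width 2 sqrt 2. *)
Definition support_point (t : R) : R := 3 + 2 * q * cos t.
Local Notation y := support_point.

Lemma sqrt2_sqr : q ^+ 2 = 2. Proof. by rewrite sqr_sqrtr. Qed.

Lemma sqrt2_gt1 : 1 < q.
Proof. by rewrite -[ltLHS]sqrtr1 ltr_sqrt// ltr1n. Qed.

Lemma sqrt2_lt32 : 2 * q < 3.
Proof. by have := sqrt2_sqr; have := sqrt2_gt1; nra. Qed.

Lemma support_point_ge t : 3 - 2 * q <= y t.
Proof. by have := cos_geN1 t; have := sqrt2_gt1; rewrite /y; nra. Qed.

Lemma support_point_gt0 t : 0 < y t.
Proof. by apply: lt_le_trans (support_point_ge t); have := sqrt2_lt32; lra. Qed.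

Lemma left_endE : 1 / (q + 1) ^+ 2 = (3 + 2 * q)^-1.
Proof. by rewrite div1r; congr (_^-1); have := sqrt2_sqr; nra. Qed.

Lemma right_endE : 1 / (q - 1) ^+ 2 = (3 - 2 * q)^-1.
Proof. by rewrite div1r; congr (_^-1); have := sqrt2_sqr; nra. Qed.

(** The density without the indicator function: it is continuous on the closed
    support. *)
Definition sigma_weight (a1 a2 x : R) : R :=
  Num.sqrt ((x - 1 / (q + 1) ^+ 2) * (1 / (q - 1) ^+ 2 - x)) / (2 * pi * x) *
  (a1 / x + a2 / x ^+ 2).

Lemma ends_mul : (3 + 2 * q) * (3 - 2 * q) = 1.
Proof. by have := sqrt2_sqr; nra. Qed.

(** The change of variables x = 1 / y, y = 3 + 2 sqrt 2 cos t: as the ends of the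
    support are inverse to each other, the radicand becomes
    (2 sqrt 2 sin t / y)^2. *)
Lemma sigma_weight_subst a1 a2 t : 0 <= t <= pi ->
  sigma_weight a1 a2 (y t)^-1 * (2 * q * sin t / y t ^+ 2) =
  4 / pi * sin t ^+ 2 * (a1 / y t + a2).
Proof.
move=> tpi; have s0 := sin_ge0_pi tpi.
have y0 := support_point_gt0 t; have yn0 : y t != 0 by rewrite gt_eqF.
have p0 : pi != 0 :> R by rewrite gt_eqF ?pi_gt0.
have q0 : 0 < q by have := sqrt2_gt1; lra.
rewrite /sigma_weight left_endE right_endE.
have e1 : (3 + 2 * q)^-1 = 3 - 2 * q.
  by apply: (mulfI (_ : 3 + 2 * q != 0)); [rewrite gt_eqF//; lra|rewrite ends_mul mulfV// gt_eqF//; lra].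
have e2 : (3 - 2 * q)^-1 = 3 + 2 * q by rewrite -e1 invrK.
rewrite e1 e2.
have -> : ((y t)^-1 - (3 - 2 * q)) * (3 + 2 * q - (y t)^-1) = (2 * q * sin t / y t) ^+ 2.
  have -> : ((y t)^-1 - (3 - 2 * q)) * (3 + 2 * q - (y t)^-1) =
    - ((3 + 2 * q) * (3 - 2 * q)) + 6 / y t - (y t) ^- 2 by field.
  rewrite ends_mul.
  have -> : (2 * q * sin t / y t) ^+ 2 = 4 * q ^+ 2 * sin t ^+ 2 / y t ^+ 2 by field.
  have -> : 4 * q ^+ 2 * sin t ^+ 2 = 8 - (y t - 3) ^+ 2.
    have -> : y t - 3 = 2 * q * cos t by rewrite /y; ring.
    by rewrite sin2cos2 !exprMn sqrt2_sqr; ring.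
  by field.
rewrite sqrtr_sqr ger0_norm; last by rewrite divr_ge0 ?mulr_ge0 ?(ltW y0)// ltW.
move: p0; clear tpi; generalize (@pi R) => p p0.
have -> : 4 / p * sin t ^+ 2 * (a1 / y t + a2) = 2 * q ^+ 2 / p * sin t ^+ 2 * (a1 / y t + a2).
  by rewrite sqrt2_sqr -natrM.
move: (y t) yn0 (sin t) (q) => u un0 v w.
by field; rewrite un0 p0.
Qed.

Lemma is_derive_support_point_inv (t : R) :
  is_derive t 1 (fun t => (y t)^-1) (2 * q * sin t / y t ^+ 2).
Proof.
have yE : y = cst 3 + (2 * q) *: (@cos R).
  by apply/funext => u; rewrite /y !fctE.
have h : is_derive t 1 y (- (2 * q * sin t)).
  have h1 : is_derive t 1 ((2 * q) *: (@cos R)) ((2 * q) *: (- sin t)) by exact: is_deriveZ.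
  have h2 : is_derive t 1 (cst 3 : R -> R) 0 by exact: is_derive_cst.
  by rewrite yE; apply: (is_derive_eq (is_deriveD h2 h1)); rewrite /GRing.scale /= add0r mulrN.
have y0 : y t != 0 by rewrite gt_eqF// support_point_gt0.
case: h => dy Dy; apply: DeriveDef; first exact: derivableV.
by rewrite deriveV// Dy /GRing.scale /= mulrNN mulrC.
Qed.

Lemma continuous_support_point : continuous y.
Proof.
by move=> t; apply: cvgD; [exact: cvg_cst|apply: cvgM; [exact: cvg_cst|exact: continuous_cos]].
Qed.

Lemma support_point_inv0 : (y 0)^-1 = 1 / (q + 1) ^+ 2.
Proof. by rewrite left_endE /y cos0 mulr1. Qed.

Lemma support_point_invpi : (y pi)^-1 = 1 / (q - 1) ^+ 2.
Proof. by rewrite right_endE /y cospi mulrN1. Qed.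

Lemma continuous_sigma_weight a1 a2 (x : R) : 0 < x -> {for x, continuous (sigma_weight a1 a2)}.
Proof.
move=> x0; have xn0 : x != 0 by rewrite gt_eqF.
have cM : (fun x : R => 2 * pi * x) u @[u --> x] --> 2 * pi * x.
  by apply: cvgM; [exact: cvg_cst|exact: cvg_id].
apply: cvgM.
  apply: cvgM.
    apply: (@continuous_comp _ _ _ (fun u : R => (u - 1 / (q + 1) ^+ 2) * (1 / (q - 1) ^+ 2 - u)) Num.sqrt).
      by apply: cvgM; apply: cvgB; [exact: cvg_id|exact: cvg_cst|exact: cvg_cst|exact: cvg_id].
    exact: sqrt_continuous.
  apply: cvgV => //.
  by rewrite !mulf_neq0// gt_eqF// pi_gt0.
apply: cvgD; apply: cvgM; try exact: cvg_cst.
  by apply: cvgV => //; exact: cvg_id.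
apply: cvgV; first by rewrite expf_neq0.
exact: exprn_continuous.
Qed.

Lemma sigma_densityE a1 a2 x : sigma_density a1 a2 x =
  sigma_weight a1 a2 x * \1_(`](y 0)^-1, (y pi)^-1[%classic) x.
Proof. by rewrite support_point_inv0 support_point_invpi. Qed.

Lemma measurable_sigma_weight a1 a2 : measurable_fun (@setT T) (sigma_weight a1 a2 : T -> R).
Proof.
have mid : measurable_fun (@setT T) (id : T -> R) by exact: measurable_id.
have mX : measurable_fun (@setT T) (fun x : T => (x : R) ^+ 2) by exact: measurable_funX.
have mV (f : T -> R) : measurable_fun (@setT T) f -> measurable_fun (@setT T) (fun x => (f x)^-1).
  by move=> mf; exact: (measurableT_comp (@measurable_inversion R) mf).
apply: measurable_funM.
  apply: measurable_funM.
    have ms : measurable_fun (@setT T) (@Num.sqrt R : T -> R).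
      exact: (continuous_measurable_fun (@sqrt_continuous R)).
    apply: (measurableT_comp ms).
    by apply: measurable_funM; apply: measurable_funB => //; exact: measurable_cst.
  apply: mV; apply: measurable_funM => //; exact: measurable_cst.
apply: measurable_funD; (apply: measurable_funM; first exact: measurable_cst); exact: mV.
Qed.

Lemma inversion_integral (a1 a2 : R) (sigma : probability T R) (g : R -> R) :
  has_distribution_sigma a1 a2 sigma -> continuous g ->
  (exists M, forall x, `|g x| <= M) ->
  \int[distribution sigma (@inversion R)]_x g x =
  \int[lambda]_(t in `[0, pi]) (g (y t) * (4 / pi * sin t ^+ 2 * (a1 / y t + a2))).
Proof.
move=> hs cg [M hM].
have mg : measurable_fun (@setT T) (g : T -> R) by exact: continuous_measurable_fun.
have bg : bounded_mfun (@setT T) g by split => //; exists M.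
rewrite Rintegral_distribution//.
have md : measurable_fun (@setT T) (sigma_density a1 a2 : T -> R).
  have -> : sigma_density a1 a2 = (fun x => sigma_weight a1 a2 x * \1_(`](y 0)^-1, (y pi)^-1[%classic) x).
    by apply/funext => x; exact: sigma_densityE.
  by apply: measurable_funM; [exact: measurable_sigma_weight|exact: measurable_indic].
have mgi : measurable_fun (@setT T) (fun x : T => g (inversion x)).
  exact: (measurableT_comp mg (@measurable_inversion R)).
rewrite (Rintegral_density md hs); last first.
  apply: (bounded_mfun_integrable (mu := sigma) measurableT (probability_setT_lty sigma)).
  by split => //; exists M.
pose H x := g x^-1 * sigma_weight a1 a2 x.
transitivity (\int[lambda]_(x in `](y 0)^-1, (y pi)^-1[) H x).
  rewrite [RHS]Rintegral_mkcond; apply: eq_Rintegral => x _.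
  rewrite sigma_densityE patchE /H /inversion indicE.
  by case: ifPn => xI; [rewrite mulr1|rewrite !mulr0].
have y00 : 0 < (y 0)^-1 by rewrite invr_gt0 support_point_gt0.
have cH x : 0 < x -> {for x, continuous H}.
  move=> x0; apply: cvgM; last exact: continuous_sigma_weight.
  apply: (@continuous_comp _ _ _ (fun u : R => u^-1) g); last exact: cg.
  by apply: inv_continuous; rewrite gt_eqF.
have cHI : {within `[(y 0)^-1, (y pi)^-1], continuous H}.
  apply: continuous_in_subspaceT => x; rewrite inE /= in_itv /= => /andP[x0 _].
  by apply: cH; apply: lt_le_trans x0.
have mH : measurable_fun (`](y 0)^-1, (y pi)^-1[%classic : set T) (H : T -> R).
  apply: measurable_funTS; apply: measurable_funM; last exact: measurable_sigma_weight.
  exact: mgi.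
rewrite /Rintegral; congr fine.
rewrite -(@integral_itv_bndoo _ _ _ _ true false); last exact/measurable_EFinP.
pose F := fun t => (y t)^-1.
have dF := is_derive_support_point_inv.
have cF : continuous F.
  by move=> x; apply: cvgV; [rewrite gt_eqF// support_point_gt0|exact: continuous_support_point].
have F' : F^`()%classic = (fun t => 2 * q * sin t / y t ^+ 2).
  by apply/funext => t; rewrite derive1E; exact: (@derive_val _ _ _ _ _ _ _ (dF t)).
have cF' : continuous F^`()%classic.
  rewrite F' => t; apply: cvgM.
    by apply: cvgM; [exact: cvg_cst|exact: continuous_sin].
  apply: cvgV; first by rewrite expf_neq0// gt_eqF// support_point_gt0.
  by rewrite expr2; apply: cvgM; exact: continuous_support_point.
rewrite (@integration_by_substitution_increasing R F H 0 pi)//.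
- apply: eq_integral => t; rewrite inE /= in_itv /= => tpi.
  congr (_%:E); rewrite F' -(sigma_weight_subst _ _ tpi) mulrA.
  by rewrite [LHS]/(H (F t) * _) /H /F invrK.
- exact: pi_ge0.
- move=> s t sI tI st; rewrite /F ltf_pV2 ?posrE ?support_point_gt0// /y ltrD2l.
  rewrite ltr_pM2l; last by have := sqrt2_gt1; lra.
  by rewrite ltr_cos.
- by apply: cvgP; apply: cvg_at_right_filter; exact: (cF' 0).
- by apply: cvgP; apply: cvg_at_left_filter; exact: (cF' pi).
- split.
  + by move=> t _; have := dF t; case.
  + by apply: cvg_at_right_filter; exact: cF.
  + by apply: cvg_at_left_filter; exact: cF.
Qed.

End sigma.

(** * The Cauchy transform of the law of the inverse *)

Section transform.
Variable R : realType.
Local Notation C := R[i].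
Local Notation T := (measurableTypeR R).
Local Notation lambda := (@lebesgue_measure R).
Local Notation q := (Num.sqrt 2 : R).
Local Notation y := (@support_point R).
Local Notation I := (`[0, pi]%classic : set T).

Lemma normcB_ge (a b : C) : Normc.normc a - Normc.normc b <= Normc.normc (a + b).
Proof. by have := le_normcD (a + b) (- b); rewrite addrK normcN; lra. Qed.

Lemma chebyshev_denom_small (s : C) t : Normc.normc s <= 1 / 4 ->
  1 / 4 <= Normc.normc (chebyshev_denom s t).
Proof.
move=> hs; rewrite /chebyshev_denom -addrA.
apply: le_trans (normcB_ge _ _); rewrite Normc.normc1.
apply: le_trans (_ : 1 - (2 * Normc.normc s + Normc.normc s ^+ 2) <= _).
  by have := normc_ge0 s; nra.
rewrite lerD2l lerN2; apply: le_trans (le_normcD _ _) _.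
rewrite normcN normcX lerD2r !Normc.normcM normcR.
have -> : Normc.normc (2 : C) = 2 by rewrite -[2 : C](rmorph_nat (real_complex R)) normcR ger0_norm.
rewrite -[leRHS]mulr1 ler_wpM2l ?mulr_ge0 ?normc_ge0//.
by rewrite ler_norml cos_geN1 cos_le1.
Qed.

Lemma bounded_sine_quotient (s : C) k : 0 < k -> (forall t, I t -> k <= Normc.normc (chebyshev_denom s t)) ->
  bounded_cmfun I (fun t => (sin t ^+ 2)%:C / chebyshev_denom s t).
Proof.
move=> k0 hk; apply: bounded_cmfunM; last exact: bounded_cmfun_inv k0 (bounded_chebyshev_denom s) hk.
apply: bounded_cmfun_real; apply: bounded_mfun_continuous; under eq_fun do rewrite expr2.
by move=> t; apply: cvgM; exact: continuous_sin.
Qed.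

Lemma real_complex_weight (p s a u b : R) :
  (4 / p * s * (a / u + b))%:C = 4 / p%:C * s%:C * (a%:C / u%:C + b%:C) :> C.
Proof.
have M (x z : R) : (x * z)%:C = x%:C * z%:C := rmorphM (real_complex R) x z.
have D (x z : R) : (x + z)%:C = x%:C + z%:C := rmorphD (real_complex R) x z.
have V (x : R) : (x^-1)%:C = (x%:C)^-1 := fmorphV (real_complex R) x.
have N : (4 : R)%:C = 4 := rmorph_nat (real_complex R) 4.
by rewrite 3!M N D M !V.
Qed.

Lemma joukowski_Im (v : C) : complex.Im v < 0 -> Normc.normc v <= 1 / 4 ->
  0 < complex.Im (3 + v + 2 / v).
Proof.
move=> v0 v4; have vn0 : v != 0 by rewrite Im_neq0// lt_eqF.
have n0 := normc_gt0 vn0.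
have -> : complex.Im (3 + v + 2 / v) = - complex.Im v * (2 / Normc.normc v ^+ 2 - 1).
  rewrite normc_sqr; have := sqrc_gt0 vn0; move: vn0 => _; case: v v0 v4 n0 => a b /= _ _ _ h.
  have h0 := lt0r_neq0 h.
  rewrite !(mulr0, mul0r, addr0, add0r, subr0).
  by field.
apply: mulr_gt0; first by rewrite oppr_gt0.
rewrite subr_gt0 ltr_pdivlMr ?exprn_gt0// mul1r.
by nra.
Qed.

(** By 1 / (y (z - y)) = (1 / y + 1 / (z - y)) / z everything reduces to the
    integrals of sin^2 / (z - y) and of sin^2 / y.  Both denominators are
    multiples of [chebyshev_denom], with parameters v / sqrt 2 and - 1 / sqrt 2
    (y = - (z - y) for z = 0, that is, for v = - 1). *)
Lemma inversion_cauchy_transform (a1 a2 : R) (sigma : probability T R) (v : C) :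
  a1 + 2 * a2 = 1 -> has_distribution_sigma a1 a2 sigma ->
  complex.Im v < 0 -> Normc.normc v <= 1 / 4 ->
  cauchy_transform (distribution sigma (@inversion R)) (3 + v + 2 / v) =
  v * (1 + a2%:C * v) / (v + 2).
Proof.
move=> ha hs v0 v4; have z0 := joukowski_Im v0 v4.
have vn0 : v != 0 by rewrite Im_neq0// lt_eqF.
have v2 : v + 2 != 0.
  by rewrite -[2](rmorph_nat (real_complex R)) Im_neq0// ImD addr0 lt_eqF.
have v1 : v + 1 != 0 by rewrite Im_neq0// ImD addr0 lt_eqF.
set z := 3 + v + 2 / v in z0 *.
have zE : z = (v + 1) * (v + 2) / v by rewrite /z; field.
pose W t := 4 / pi * sin t ^+ 2 * (a1 / y t + a2).
have cN : continuous (fun x : R => (complex.Re z - x) ^+ 2 + complex.Im z ^+ 2).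
  move=> x; apply: cvgD; last exact: cvg_cst.
  by rewrite expr2; apply: cvgM; apply: cvgB; [exact: cvg_cst|exact: cvg_id|exact: cvg_cst|exact: cvg_id].
have N0 x : (complex.Re z - x) ^+ 2 + complex.Im z ^+ 2 != 0.
  by rewrite gt_eqF// ltr_wpDl ?sqr_ge0// exprn_gt0.
have GE : cauchy_transform (distribution sigma (@inversion R)) z =
    cintegral lambda I (fun t => (z - (y t)%:C)^-1 * (W t)%:C).
  rewrite /cauchy_transform /cintegral; congr (_ +i* _).
    rewrite (inversion_integral (g := fun x => complex.Re (z - x%:C)^-1) hs).
    - apply: eq_Rintegral => t _; rewrite ReM /= mulr0 subr0 //.
    - under eq_fun do rewrite ReV Re_subr Im_subr.
      move=> x; apply: cvgM; last by apply: cvgV; [exact: N0|exact: cN].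
      by apply: cvgB; [exact: cvg_cst|exact: cvg_id].
    - exists (complex.Im z)^-1 => x.
      by apply: le_trans (Re_le_normc _) _; exact: cauchy_kernel_bound.
  rewrite (inversion_integral (g := fun x => complex.Im (z - x%:C)^-1) hs).
  - apply: eq_Rintegral => t _; rewrite ImM /= mulr0 add0r //.
  - under eq_fun do rewrite ImV Re_subr Im_subr.
    move=> x; apply: cvgM; last by apply: cvgV; [exact: N0|exact: cN].
    exact: cvg_cst.
  - exists (complex.Im z)^-1 => x.
    by apply: le_trans (Im_le_normc _) _; exact: cauchy_kernel_bound.
have q0 : 0 < q by have := @sqrt2_gt1 R; lra.
pose s : C := v / q%:C; pose s0 : C := - (q^-1)%:C.
have qC : q%:C != 0 by rewrite eq_complex /= negb_and gt_eqF.
have qC2 : q%:C ^+ 2 = 2 by rewrite -rmorphXn /= sqrt2_sqr rmorph_nat.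
have qi : q%:C^-1 = q%:C / 2.
  by apply: (mulfI qC); rewrite mulfV// mulrA -expr2 qC2 mulfV// pnatr_eq0.
have sn : Normc.normc s <= 1 / 4.
  rewrite Normc.normcM Normc.normcV normcR gtr0_norm// ler_pdivrMr//.
  apply: le_trans v4 _; have := @sqrt2_gt1 R; lra.
have hden t : I t -> 1 / 4 <= Normc.normc (chebyshev_denom s t) by move=> _; exact: chebyshev_denom_small.
have yden t : (y t)%:C = 2 * chebyshev_denom s0 t.
  rewrite /support_point /chebyshev_denom /s0 rmorphD !rmorphM /= fmorphV !rmorph_nat qi.
  transitivity (2 + 2 * q%:C * (cos t)%:C + q%:C ^+ 2 / 2); first by rewrite qC2; field.
  by field.
have zden t : z - (y t)%:C = 2 / v * chebyshev_denom s t.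
  rewrite /support_point /chebyshev_denom /s /z rmorphD !rmorphM /= !rmorph_nat qi.
  transitivity (v + 2 / v - 2 * q%:C * (cos t)%:C); first by ring.
  transitivity (v * q%:C ^+ 2 / 2 + 2 / v - 2 * q%:C * (cos t)%:C); first by rewrite qC2; field.
  by field.
have s0n : Normc.normc s0 < 1.
  rewrite normcN normcR gtr0_norm ?invr_gt0// invf_lt1//; exact: sqrt2_gt1.
pose k0 := (3 - 2 * q) / 2.
have k00 : 0 < k0 by rewrite divr_gt0// subr_gt0 sqrt2_lt32.
have hden0 t : I t -> k0 <= Normc.normc (chebyshev_denom s0 t).
  move=> _; have := support_point_ge t.
  have -> : y t = 2 * Normc.normc (chebyshev_denom s0 t).
    rewrite -[LHS]gtr0_norm ?support_point_gt0// -normcR yden Normc.normcM; congr (_ * _).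
    by rewrite -[2 : C](rmorph_nat (real_complex R)) normcR ger0_norm.
  rewrite /k0; lra.
have i4 : 0 < 1 / 4 :> R by lra.
have s1 : Normc.normc s < 1 by lra.
have Is := sine_integral s1 i4 hden.
have Is0 := sine_integral s0n k00 hden0.
have bs := bounded_sine_quotient i4 hden; have bs0 := bounded_sine_quotient k00 hden0.
have pC : pi%:C != 0 :> C by rewrite eq_complex /= negb_and gt_eqF ?pi_gt0.
rewrite GE.
have den_neq0 t : chebyshev_denom s t != 0.
  by have := chebyshev_denom_small t sn; apply: contraTneq => ->; rewrite Normc.normc0 -ltNge; lra.
have den0_neq0 t : chebyshev_denom s0 t != 0.
  apply: contraTneq k00 => h; rewrite -leNgt.
  rewrite -(Normc.normc0 R) -h.
  have := support_point_ge t; have := yden t; rewrite h mulr0 => /complexI yt0.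
  by have := support_point_gt0 t; rewrite yt0 ltxx.
have zn0 : z != 0 by rewrite Im_neq0// gt_eqF.
transitivity (cintegral lambda I (fun t =>
   (4 / pi%:C * a1%:C / z / 2) * ((sin t ^+ 2)%:C / chebyshev_denom s0 t) +
   (4 / pi%:C * (a1%:C / z + a2%:C) * v / 2) * ((sin t ^+ 2)%:C / chebyshev_denom s t))).
  apply: eq_cint => t _; rewrite /W.
  have ynt : (y t)%:C != 0 by rewrite eq_complex /= negb_and gt_eqF// support_point_gt0.
  have znt : z - (y t)%:C != 0 by rewrite zden !mulf_neq0 ?invr_neq0// pnatr_eq0.
  have -> : chebyshev_denom s0 t = (y t)%:C / 2 by rewrite yden mulrAC divff ?mul1r// pnatr_eq0.
  have -> : chebyshev_denom s t = (z - (y t)%:C) * v / 2 by rewrite zden; field.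
  rewrite /W real_complex_weight.
  move: (z) zn0 (y t)%:C ynt znt (sin t ^+ 2)%:C (pi%:C) pC => Z Z0 Y Y0 ZY S P P0.
  by field; rewrite Y0 ZY P0 Z0 vn0.
have measurable_0pi := @measurable_0pi R; have lI := @lebesgue_0pi_lty R.
rewrite (cintegralD measurable_0pi lI (bounded_cmfunZ _ bs0) (bounded_cmfunZ _ bs)) (cintegralZ measurable_0pi lI _ bs0) (cintegralZ measurable_0pi lI _ bs).
rewrite Is Is0 rmorphM /= fmorphV rmorph_nat.
have -> : a1%:C = 1 - 2 * a2%:C :> C.
  have -> : a1 = 1 - 2 * a2 by lra.
  by rewrite rmorphB rmorph1 rmorphM rmorph_nat.
rewrite zE; move: (pi%:C) pC => P P0.
by field; rewrite v2 vn0 v1 P0.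
Qed.

End transform.

(** * Following the inverse along a ray *)

Section path.
Variables (R : realType) (a1 a2 p : R).
Hypotheses (ha1 : 0 < a1) (ha2 : 0 < a2) (ha : a1 + 2 * a2 = 1) (p0 : 0 < p).
Local Notation C := R[i].
Local Notation K := (4 + p ^+ 2).

(** The segment on which the Joukowski variable v moves. *)
Definition ray (t : R) : C := ((- 2) +i* (- p)) * t%:C.
Definition ray_den t : C := 1 + a2%:C * ray t.
(** 1 / w, where w = v (1 + a2 v) / (v + 2), in partial fractions. *)
Definition ray_inv t : C := 2 / ray t + a1%:C / ray_den t.
(** The R-transform z - 1 / w of the law of 1 / X at w. *)
Definition ray_shift t : C := 3 + ray t - a1%:C / ray_den t.
(** The point at which the Cauchy transform of an N-fold free root takes the
    value w. *)
Definition ray_root (N t : R) : C := ray_inv t + (N^-1)%:C * ray_shift t.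

Lemma Im_mulC (x : R) (z : C) : complex.Im (x%:C * z) = x * complex.Im z.
Proof. by case: z => u v /=; rewrite mul0r addr0. Qed.

Lemma Re_mulC (x : R) (z : C) : complex.Re (x%:C * z) = x * complex.Re z.
Proof. by case: z => u v /=; rewrite mul0r subr0. Qed.

Lemma K_gt0 : 0 < K. Proof. by rewrite ltr_pwDl// sqr_ge0. Qed.

Section at_t.
Variable t : R.
Hypotheses (t0 : 0 < t) (t1 : t <= 1).

Lemma rayE : ray t = (- 2 * t) +i* (- (p * t)).
Proof. by rewrite /ray -[LHS]/((_ - _) +i* (_ + _)); congr (_ +i* _); ring. Qed.

Lemma ray_Im : complex.Im (ray t) < 0.
Proof. by rewrite rayE /= oppr_lt0 mulr_gt0. Qed.

Lemma ray_neq0 : ray t != 0.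
Proof. by rewrite Im_neq0// lt_eqF// ray_Im. Qed.

Lemma ray_denE : ray_den t = (1 - 2 * a2 * t) +i* (- (a2 * p * t)).
Proof. by rewrite /ray_den rayE -[LHS]/((_ + (_ - _)) +i* (_ + (_ + _))); congr (_ +i* _); ring. Qed.

Lemma ray_den_neq0 : ray_den t != 0.
Proof. by rewrite Im_neq0// ray_denE /= lt_eqF// oppr_lt0 !mulr_gt0. Qed.

Lemma ray_add2_neq0 : ray t + 2 != 0.
Proof.
by rewrite -[2](rmorph_nat (real_complex R)) Im_neq0// ImD addr0 lt_eqF// ray_Im.
Qed.

Lemma ray_den_Re : a1 <= complex.Re (ray_den t).
Proof. by rewrite ray_denE /=; have := ha2; have := ha; have := t1; nra. Qed.

Let S := complex.Re (ray_den t) ^+ 2 + complex.Im (ray_den t) ^+ 2.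

Lemma ray_den_sqr : a1 ^+ 2 <= S.
Proof.
apply: ler_wpDr; first exact: sqr_ge0.
by rewrite ler_sqr ?nnegrE ?(ltW ha1)// ?ray_den_Re// (le_trans (ltW ha1) ray_den_Re).
Qed.

Lemma ray_den_sqr_gt0 : 0 < S.
Proof. by apply: lt_le_trans ray_den_sqr; rewrite exprn_gt0. Qed.

Definition ray_beta := complex.Im (a1%:C / ray_den t).

Lemma ray_beta_ge0 : 0 <= ray_beta.
Proof.
rewrite /ray_beta Im_mulC ImV -/S mulr_ge0 ?(ltW ha1)// divr_ge0 ?(ltW ray_den_sqr_gt0)//.
by rewrite ray_denE /= opprK !mulr_ge0// ltW.
Qed.

Lemma ray_beta_le : ray_beta <= a2 * p * t / a1.
Proof.
rewrite /ray_beta Im_mulC ImV -/S {1}ray_denE /= opprK.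
have h := ray_den_sqr; have s0 := ray_den_sqr_gt0.
rewrite mulrA ler_pdivrMr// -[leLHS]mul1r.
have -> : a2 * p * t / a1 * S = (S / a1 ^+ 2) * (a1 * (a2 * p * t)).
  by field; rewrite gt_eqF.
rewrite ler_wpM2r//; first by rewrite !mulr_ge0// ltW.
by rewrite ler_pdivlMr ?exprn_gt0// mul1r.
Qed.

Lemma ray_quotient_Re_le : `|complex.Re (a1%:C / ray_den t)| <= 1.
Proof.
apply: le_trans (Re_le_normc _) _.
rewrite Normc.normcM normcR gtr0_norm// Normc.normcV ler_pdivrMr ?normc_gt0 ?ray_den_neq0// mul1r.
by apply: le_trans ray_den_Re _; apply: le_trans (Re_le_normc _); exact: ler_norm.
Qed.

Lemma ray_two_inv : 2 / ray t = (- 4 / (t * K)) +i* (2 * p / (t * K)).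
Proof.
have tn0 : t != 0 by rewrite gt_eqF.
have Kn0 : 4 + p ^+ 2 != 0 by rewrite gt_eqF// K_gt0.
have -> : (2 : C) = (2 : R)%:C by rewrite rmorph_nat.
rewrite rayE -[LHS]/((_ : C) * _).
have d : (- 2 * t) ^+ 2 + (- (p * t)) ^+ 2 = t ^+ 2 * K by ring.
apply/eqP; rewrite eq_complex Re_mulC Im_mulC ReV ImV /= d opprK.
by apply/andP; split; apply/eqP; field; rewrite tn0 Kn0.
Qed.

Lemma ray_inv_Im : complex.Im (ray_inv t) = 2 * p / (t * K) + ray_beta.
Proof. by rewrite /ray_inv ImD ray_two_inv. Qed.

Lemma tK_gt0 : 0 < t * K. Proof. by rewrite mulr_gt0// K_gt0. Qed.

Lemma ray_inv_Im_gt0 : 0 < complex.Im (ray_inv t).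
Proof.
by rewrite ray_inv_Im ltr_pwDl ?ray_beta_ge0// !(divr_gt0, mulr_gt0)// K_gt0.
Qed.

Lemma ray_inv_Re : `|complex.Re (ray_inv t)| <= (8 + p ^+ 2) / (t * K).
Proof.
rewrite /ray_inv ReD ray_two_inv /=; apply: le_trans (ler_normD _ _) _.
have h := ray_quotient_Re_le; rewrite mulNr normrN [`|4 / _|]ger0_norm; last first.
  by rewrite divr_ge0// ltW// tK_gt0.
apply: le_trans (_ : 4 / (t * K) + K / (t * K) <= _).
  rewrite lerD2l; apply: le_trans h _; rewrite ler_pdivlMr ?tK_gt0// mul1r.
  by rewrite -[leRHS]mul1r ler_wpM2r// ltW// K_gt0.
by rewrite -mulrDl addrA -natrD.
Qed.

Lemma ray_invE : ray_inv t = (ray t + 2) / (ray t * ray_den t).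
Proof.
have a1E : a1%:C = 1 - 2 * a2%:C.
  have -> : a1 = 1 - 2 * a2 by have := ha; lra.
  by rewrite rmorphB rmorph1 rmorphM rmorph_nat.
rewrite /ray_inv a1E; have := ray_den_neq0; have := ray_neq0; rewrite /ray_den.
by move: (ray t) => u u0 d0; field; rewrite u0 d0.
Qed.

Lemma ray_shift_Im : complex.Im (ray_shift t) = - (p * t) - ray_beta.
Proof.
rewrite /ray_shift -[3](rmorph_nat (real_complex R)) ImD ImN ImD rayE.
by rewrite [complex.Im (3%:C)]/= add0r.
Qed.

Lemma ray_zE : 3 + ray t + 2 / ray t = ray_inv t + ray_shift t.
Proof. by rewrite /ray_inv /ray_shift; ring. Qed.

(** Dividing by N weakens the shift, whose imaginary part is negative and bounded,
    while Im (2 / v) is at least 2 p / (4 + p^2): the root remains in the region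
    where Cauchy transforms are injective, along the whole segment. *)
Lemma ray_root_Im N : K < N -> complex.Im (ray_inv t) < 2 * complex.Im (ray_root N t).
Proof.
move=> KN.
have -> : complex.Im (ray_root N t) = complex.Im (ray_inv t) + N^-1 * complex.Im (ray_shift t).
  by rewrite /ray_root ImD Im_mulC.
rewrite ray_shift_Im ray_inv_Im.
have k0 := K_gt0; have N0 : 0 < N by lra.
have b0 := ray_beta_ge0.
have h1 : p * t / N < p / (t * K).
  rewrite ltr_pdivrMr// mulrAC ltr_pdivlMr ?tK_gt0// -mulrA ltr_pM2l//.
  apply: le_lt_trans KN; rewrite mulrA -[leRHS]mul1r ler_wpM2r ?(ltW k0)//.
  by rewrite mulr_ile1// ltW.
have h2 : 2 * (ray_beta / N) <= ray_beta.
  rewrite mulrCA -[leRHS]mulr1 ler_wpM2l// ler_pdivrMr// mul1r.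
  by have := sqr_ge0 p; lra.
have -> : N^-1 * (- (p * t) - ray_beta) = - (p * t / N) - ray_beta / N by ring.
have -> : 2 * p / (t * K) = 2 * (p / (t * K)) by rewrite mulrA.
lra.
Qed.

(** The undivided shift needs a small t instead. *)
Lemma ray_z_Im : t * ((2 + a2 / a1) * K) < 2 ->
  complex.Im (ray_inv t) < 2 * complex.Im (3 + ray t + 2 / ray t).
Proof.
move=> h; rewrite ray_zE.
have -> : complex.Im (ray_inv t + ray_shift t) = complex.Im (ray_inv t) + complex.Im (ray_shift t) by exact: ImD.
rewrite ray_shift_Im ray_inv_Im.
have hb := ray_beta_le; have k0 := K_gt0; have tk0 := tK_gt0.
have h1 : p * t * (2 + a2 / a1) < 2 * p / (t * K).
  rewrite ltr_pdivlMr//.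
  have -> : p * t * (2 + a2 / a1) * (t * K) = p * (t * (t * ((2 + a2 / a1) * K))) by ring.
  rewrite [ltRHS]mulrC ltr_pM2l//; apply: le_lt_trans h; rewrite -[leRHS]mul1r.
  by rewrite ler_wpM2r// mulr_ge0 ?mulr_ge0 ?(ltW t0) ?(ltW k0)// addr_ge0// divr_ge0// ltW.
have e : p * t * (2 + a2 / a1) = 2 * (p * t) + a2 * p * t / a1 by ring.
lra.
Qed.

Lemma ray_inv_neq0 : ray_inv t != 0.
Proof. by rewrite Im_neq0// gt_eqF// ray_inv_Im_gt0. Qed.

(** As t tends to 0, w ~ v / 2 approaches 0 in the direction - 2 - i p, so a
    sufficiently wide cone contains it. *)
Lemma ray_Lambda d : t * K < 2 * p * d -> Lambda (p / (8 + p ^+ 2)) d (ray_inv t)^-1.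
Proof.
move=> td; have tk0 := tK_gt0.
have S0 := sqrc_gt0 ray_inv_neq0.
have I0 := ray_inv_Im_gt0.
have I1 : 2 * p / (t * K) <= complex.Im (ray_inv t) by rewrite ray_inv_Im lerDl ray_beta_ge0.
have p8 : 0 < 8 + p ^+ 2 by rewrite ltr_pwDl// sqr_ge0.
split; first last.
  split; last by rewrite ImV mulNr oppr_lt0 divr_gt0.
  rewrite ImV mulNr ltrN2 ltr_pdivrMr//.
  have d0 : 0 < d by move: td; rewrite -subr_gt0 => ?; have := p0; nra.
  apply: lt_le_trans (_ : d * complex.Im (ray_inv t) ^+ 2 <= _); last first.
    by rewrite ler_wpM2l ?(ltW d0)// lerDr sqr_ge0.
  rewrite expr2 mulrA -[ltLHS]mul1r ltr_pM2r//.
  apply: lt_le_trans (_ : d * (2 * p / (t * K)) <= _); last by rewrite ler_pM2l.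
  by rewrite mulrA ltr_pdivlMr// mul1r [ltRHS]mulrC.
rewrite ReV ImV normrM normfV [in X in _ * (_ / X)]gtr0_norm// mulrA mulNr opprK.
rewrite ltr_pM2r ?invr_gt0//.
apply: le_lt_trans (_ : p / (t * K) < _).
  apply: le_trans (ler_wpM2l _ ray_inv_Re) _; first by rewrite divr_ge0// ltW.
  by rewrite mulrA divfK// gt_eqF.
apply: lt_le_trans I1; rewrite ltr_pM2r ?invr_gt0//; have := p0; lra.
Qed.

End at_t.

Variable sigma : probability (measurableTypeR R) R.
Hypothesis hsigma : has_distribution_sigma a1 a2 sigma.
Local Notation mu := (distribution sigma (@inversion R)).

(** The explicit formula gives a preimage z of w that satisfies the condition of
    [cauchy_transform_inj], so z is the value of every right inverse. *)
Lemma ray_apex H : apex_inverse mu (p / (8 + p ^+ 2)) H ->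
  exists2 tau, 0 < tau & forall t, 0 < t <= 1 -> t < tau ->
    H (ray_inv t)^-1 = 3 + ray t + 2 / ray t.
Proof.
move=> [d d0 hH].
have k0 := K_gt0.
have x0 : 0 < (2 + a2 / a1) * K by rewrite mulr_gt0// addr_gt0// divr_gt0.
exists (Num.min (2 * p * d / K) (Num.min (2 / ((2 + a2 / a1) * K)) (1 / 4 / (2 + p)))).
  by rewrite !lt_min !divr_gt0// ?mulr_gt0// addr_gt0.
move=> t /andP[t0 t1]; rewrite !lt_min => /andP[h1 /andP[h2 h3]].
rewrite ltr_pdivlMr// in h1; rewrite ltr_pdivlMr// in h2.
rewrite ltr_pdivlMr ?addr_gt0// in h3.
have [w0 w1 w2] := hH _ (ray_Lambda t0 t1 h1).
rewrite invrK in w0 w1.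
apply: (cauchy_transform_inj (mu := mu) (w := (ray_inv t)^-1)); rewrite ?invrK//.
- exact: ray_z_Im.
- rewrite (inversion_cauchy_transform ha hsigma)//.
  + by rewrite ray_invE// invf_div /ray_den.
  + exact: ray_Im.
  + rewrite Normc.normcM normcR gtr0_norm// mulrC; apply: le_trans (ltW h3).
    rewrite ler_pM2l//; apply: le_trans (normc_le_ReIm _) _ => /=.
    by rewrite !normrN ger0_norm// ger0_norm// ltW.
Qed.

(** The root equation holds for small t by the additivity of the R-transform, and
    then up to t = 1 by analytic continuation. *)
Lemma ray_end (n : nat) rho : K < n%:R -> is_free_power rho n mu ->
  cauchy_transform rho (ray_root n%:R 1) = (ray_inv 1)^-1.
Proof.
move=> Kn fp.
have k0 := K_gt0.
have n1 : (1 < n)%N.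
  by rewrite -(ltr_nat R); apply: lt_trans Kn; have := sqr_ge0 p; lra.
have nC : n%:R != 0 :> C by rewrite pnatr_eq0 -lt0n ltnW.
pose g := p / (8 + p ^+ 2).
have g0 : 0 < g by rewrite divr_gt0// ltr_pwDl// sqr_ge0.
have [Hr [Hm [rH mH]]] := free_power_apex_exists g0 n1 fp.
have [d d0 hd] := free_power_apex g0 fp rH mH.
have [d' d'0 hd'] := rH.
have [tau tau0 htau] := ray_apex mH.
pose e := Num.min d d'; have e0 : 0 < e by rewrite lt_min d0.
have [V VE] : exists V : {poly C}, forall t, V.[t%:C] = ray t.
  by exists (((- 2) +i* (- p))%:P * 'X) => t; rewrite hornerM hornerC hornerX.
have [B BE] : exists B : {poly C}, forall t, B.[t%:C] = ray_den t.
  by exists (1 + a2%:C%:P * V) => t; rewrite hornerD hornerM !hornerC VE.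
pose Q := V * B.
(* P / Q is the path of the root: 1 / w = (v + 2) / (v (1 + a2 v)) has the
   denominator Q, and z - 1 / w is brought to the same denominator. *)
pose P : {poly C} := V + 2%:P + (n%:R^-1)%:P * ((V ^+ 2 + 3%:P * V + 2%:P) * B - (V + 2%:P)).
have QE t : Q.[t%:C] = ray t * ray_den t by rewrite /Q hornerM VE BE.
have nE : (n%:R^-1)%:C = n%:R^-1 :> C by rewrite fmorphV rmorph_nat.
have ZE t : 0 < t <= 1 -> P.[t%:C] / Q.[t%:C] = ray_root n%:R t.
  move=> /andP[t0 t1].
  have r0 := ray_neq0 t0; have b0 := ray_den_neq0 t0.
  have RE : ray_shift t = 3 + ray t + 2 / ray t - ray_inv t by rewrite ray_zE addrAC subrr add0r.
  rewrite /ray_root RE ray_invE// nE QE /P !(hornerD, hornerN, hornerM, hornerC, horner_exp) BE VE.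
  by move: (ray t) (ray_den t) r0 b0 => x y x0 y0; field; rewrite x0 y0 nC.
have Zd t : 0 < t <= 1 -> quotient_in_uhp P Q t.
  move=> t01; have /andP[t0 t1] := t01; split.
    by rewrite QE mulf_neq0 ?ray_neq0 ?ray_den_neq0.
  rewrite ZE//; have := ray_root_Im t0 t1 Kn; have := ray_inv_Im_gt0 t0 t1; lra.
have idt t : 0 < t <= 1 -> t < Num.min tau (2 * p * e / K) ->
    (V + 2%:P).[t%:C] * cauchy_transform rho (P.[t%:C] / Q.[t%:C]) = Q.[t%:C].
  move=> t01; have /andP[t0 t1] := t01; rewrite lt_min => /andP[ttau].
  rewrite ltr_pdivlMr// => te.
  have L := ray_Lambda t0 t1 te.
  have Ld : Lambda g d (ray_inv t)^-1 by apply: LambdaS L; rewrite ge_min lexx.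
  have Ld' : Lambda g d' (ray_inv t)^-1 by apply: LambdaS L; rewrite ge_min lexx orbT.
  have := hd _ Ld; rewrite (htau _ t01 ttau) invrK ray_zE addrAC subrr add0r => hR.
  have HZ : Hr (ray_inv t)^-1 = ray_root n%:R t.
    by rewrite /ray_root hR nE mulKf// addrC subrK.
  have [_ _ GZ] := hd' _ Ld'.
  rewrite ZE// -HZ GZ hornerD hornerC VE QE ray_invE// invf_div.
  by rewrite mulrC divfK// ray_add2_neq0.
have m0 : 0 < Num.min tau (2 * p * e / K).
  by rewrite lt_min tau0 divr_gt0// !mulr_gt0.
have := continuation m0 Zd idt.
have e1 : 0 < (1 : R) <= 1 by rewrite ltr01 lexx.
have l1 : (0 : R) < 1 by [].
have l2 : (1 : R) <= 1 by [].
have -> : (V + 2%:P).[1%:C] = ray 1 + 2 by rewrite hornerD hornerC VE.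
rewrite (ZE _ e1) QE ray_invE// invf_div => E.
by apply: (mulfI (ray_add2_neq0 l1)); rewrite E [RHS]mulrCA mulfV ?mulr1// ray_add2_neq0.
Qed.

(** Symmetric under p |-> 2 a1 / (a2 p). *)
Lemma ray_end_w : (ray_inv 1)^-1 = (a1 - 2 * a2) +i* (- (a2 * p + 2 * a1 / p)).
Proof.
have l1 : (0 : R) < 1 by [].
rewrite ray_invE// invf_div; apply: (mulIf (ray_add2_neq0 l1)); rewrite divfK ?ray_add2_neq0//.
rewrite rayE ray_denE -[2 : C](rmorph_nat (real_complex R)).
have pn0 : p != 0 by rewrite gt_eqF.
have -> : a1 = 1 - 2 * a2 by have := ha; lra.
by apply/eqP; rewrite eq_complex /=; apply/andP; split; apply/eqP; field.
Qed.

Lemma ray_end_z : complex.Re (3 + ray 1 + 2 / ray 1) = 1 - 4 / K.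
Proof.
have l1 : (0 : R) < 1 by [].
rewrite -[3](rmorph_nat (real_complex R)) !ReD ray_two_inv// rayE.
rewrite [complex.Re (3%:C)]/= [complex.Re (_ +i* _)]/= [complex.Re ((- 4 / _) +i* _)]/= mul1r.
by ring.
Qed.

End path.

(** * The contradiction *)

Theorem theorem5p3 (R : realType) (a1 a2 : R)
    (ha1 : 0 < a1) (ha2 : 0 < a2) (ha : a1 + 2 * a2 = 1)
    (sigma : probability (measurableTypeR R) R)
    (hsigma : has_distribution_sigma a1 a2 sigma) :
  ~ freely_infinitely_divisible (distribution sigma (@inversion R)).
Proof.
move=> FID.
(* p p' = c, and p' < 1 < p makes them distinct. *)
pose c := 2 * a1 / a2; have c0 : 0 < c by rewrite divr_gt0// mulr_gt0.
pose p := 1 + c; pose p' := c / p.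
have p0 : 0 < p by rewrite addr_gt0.
have p'0 : 0 < p' by rewrite divr_gt0.
have p'p : p' < p.
  apply: lt_trans (_ : 1 < _); first by rewrite ltr_pdivrMr// mul1r /p ltrDr.
  by rewrite /p ltrDl.
pose M := Num.max (4 + p ^+ 2) (4 + p' ^+ 2).
pose n := (Num.truncn M).+1.
have Mn : M < n%:R by exact: truncnS_gt.
have [Kn Kn'] : 4 + p ^+ 2 < n%:R /\ 4 + p' ^+ 2 < n%:R by move: Mn; rewrite gt_max => /andP[].
have [rho fp] := FID n isT.
have E := ray_end ha1 ha2 ha p0 hsigma Kn fp.
have E' := ray_end ha1 ha2 ha p'0 hsigma Kn' fp.
have l1 : (0 : R) < 1 by [].
have l2 : (1 : R) <= 1 by [].
have wE : ray_inv a1 a2 p 1 = ray_inv a1 a2 p' 1.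
  apply: invr_inj; rewrite !ray_end_w//; congr (_ +i* (- _)).
  rewrite /p' /c; have pn0 : p != 0 by rewrite gt_eqF.
  by field; rewrite pn0 !gt_eqF.
have ZZ : ray_root a1 a2 p n%:R 1 = ray_root a1 a2 p' n%:R 1.
  apply: (cauchy_transform_inj (mu := rho) (w := (ray_inv a1 a2 p 1)^-1)); rewrite ?invrK//.
  - exact: ray_inv_Im_gt0.
  - exact: ray_root_Im.
  - by rewrite wE; exact: ray_root_Im.
  - by rewrite wE.
have nC : (n%:R^-1)%:C != 0 :> R[i].
  by rewrite fmorphV rmorph_nat invr_neq0// pnatr_eq0.
have := ZZ; rewrite /ray_root wE => /addrI/(mulfI nC) RR.
have := ray_end_z p; rewrite (ray_zE a1 a2) wE RR -ray_zE ray_end_z.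
move=> /addrI/oppr_inj/(mulfI _) h.
have k0 := K_gt0 p; have k'0 := K_gt0 p'.
have : 4 + p' ^+ 2 = 4 + p ^+ 2 by apply: invr_inj; apply: h; rewrite pnatr_eq0.
nra.
Qed.
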